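(* Let $\sigma=\sum_{k=1}^d\sigma_k|v_k\rangle\langle v_k|$ and $\sigma'=\sum_{k=1}^d\sigma'_k|v_k\rangle\langle v_k|$ be two commuting full-rank density operators, diagonal in the same orthonormal basis $(v_k)$ of the $d$-dimensional Hilbert space $\mathcal H$. Let $$\mathcal L_\sigma(X)=\sum_{j=1}^J\big(e^{-\omega_j/2}V_j^*[X,V_j]+e^{\omega_j/2}[V_j,X]V_j^*\big),\qquad \mathcal L_{\sigma'}(X)=\sum_{j=1}^J\big(e^{-\nu_j/2}V_j^*[X,V_j]+e^{\nu_j/2}[V_j,X]V_j^*\big)$$ be the generators of two primitive quantum Markov semigroups satisfying the $\sigma$-GNS and the $\sigma'$-GNS detailed balance condition, respectively, where the same operators $V_j$ appear in both and $\sigma V_j\sigma^{-1}=e^{-\omega_j}V_j$, $\sigma'V_j\sigma'^{-1}=e^{-\nu_j}V_j$. Then for every $p\in(1,2]$, $$\frac{\Lambda_{\min}}{\Lambda_{\max}}\ \min_j e^{-\frac{|\omega_j-\nu_j|(2-p)}{2p}}\ \alpha_p(\mathcal L_{\sigma'})\ \le\ \alpha_p(\mathcal L_\sigma),\qquad \Lambda_{\min}=\min_k\frac{\sigma_k}{\sigma'_k},\quad \Lambda_{\max}=\max_k\frac{\sigma_k}{\sigma'_k},$$ where $\alpha_p(\cdot)$ denotes the optimal constant in the $p$-Beckner inequality (with respect to the corresponding invariant state $\sigma$ or $\sigma'$).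
   Context: A quantum Markov semigroup (QMS) is a $C_0$-semigroup of completely positive unital maps on $\mathcal B(\mathcal H)$; it is primitive if it has a unique invariant state (a state $\tau$ with $\mathcal P_t^\dagger(\tau)=\tau$ for all $t$, $\dagger$ the Hilbert–Schmidt adjoint) and this state has full rank. The $\tau$-GNS detailed balance condition means that the generator $\mathcal L$ is self-adjoint for $\langle X,Y\rangle_{\tau,1}=\mathrm{Tr}(\tau X^*Y)$; then $\tau$ is invariant. The $\omega_j,\nu_j$ are real; the $V_j$ have trace zero, are mutually orthogonal for the Hilbert–Schmidt inner product, and for each $j$ there is $j'$ with $V_j^*=V_{j'}$, $\omega_{j'}=-\omega_j$, $\nu_{j'}=-\nu_j$ (Alicki's form of the generator of a QMS with GNS detailed balance). For a full-rank state $\tau$ let $\Gamma_\tau^{s}(X)=\tau^{s/2}X\tau^{s/2}$, $\|X\|_{p,\tau}=\mathrm{Tr}\big(|\Gamma_\tau^{1/p}(X)|^p\big)^{1/p}$, $\langle X,Y\rangle_{\tau,1/2}=\mathrm{Tr}(\tau^{1/2}X^*\tau^{1/2}Y)$, $\hat p=p/(p-1)$. If $\mathcal L$ has invariant state $\tau$, then for $X>0$ $$\mathcal E_{p,\mathcal L}(X)=-\frac{\hat p\,p}{4}\Big\langle \Gamma_\tau^{-1/\hat p}\big((\Gamma_\tau^{1/p}(X))^{p-1}\big),\mathcal L(X)\Big\rangle_{\tau,1/2},$$ and $\alpha_p(\mathcal L)$ is the largest constant $\alpha_p$ such that $\alpha_p\,\hat p\,(\|X\|_{p,\tau}^p-\|X\|_{1,\tau}^p)\le\mathcal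 E_{p,\mathcal L}(X)$ for all $X>0$ ($p$-Beckner inequality). *)

(* Defs.v *)
From HB Require Import structures.
From mathcomp Require Import all_boot all_order all_algebra.
From mathcomp Require Import complex.
From mathcomp Require Import all_classical all_reals all_analysis.

Set Implicit Arguments.
Unset Strict Implicit.
Unset Printing Implicit Defensive.

Import Order.TTheory GRing.Theory Num.Theory.
Import numFieldNormedType.Exports.

Local Open Scope classical_set_scope.
Local Open Scope ring_scope.
Local Open Scope sesquilinear_scope.

(** Operators on the Hilbert space C^d are matrices ['M[R[i]]_d]; vectors are
    columns.  The order on [R[i]] is partial: [0 <= z] says that [z] is real and
    nonnegative. *)

Section Operators.
Variables (R : realType) (d : nat).
Local Notation C := R[i].
Local Notation op := 'M[C]_d.

Definition psd (A : op) : Prop :=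
  forall v : 'cV[C]_d, 0 <= (v^t* *m A *m v) 0 0.

Definition posdef (A : op) : Prop :=
  forall v : 'cV[C]_d, v != 0 -> 0 < (v^t* *m A *m v) 0 0.

Definition density (rho : op) : Prop := psd rho /\ \tr rho = 1.

Definition full_rank (rho : op) : Prop := \rank rho = d.

Definition orthonormal_basis (v : 'I_d -> 'cV[C]_d) : Prop :=
  forall k l, ((v k)^t* *m v l) 0 0 = (k == l)%:R.

Definition commutator (A B : op) : op := A *m B - B *m A.

(** Hilbert-Schmidt inner product, conjugate-linear in the first argument. *)
Definition hsdot (A B : op) : C := \tr (A^t* *m B).

(** The entry [(i, j)] of [Phi^dagger Y] is
    [<E_ij, Phi^dagger Y> = <Phi E_ij, Y>]; see [hsadjP]. *)
Definition hsadj (Phi : op -> op) (Y : op) : op :=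
  \matrix_(i, j) hsdot (Phi (delta_mx i j)) Y.

(** Functional calculus [f(A)], meaningful for Hermitian [A]: with
    [P := spectralmx A] unitary, [A = P^-1 *m diag_mx (spectral_diag A) *m P]. *)
Definition mxfun (f : R -> R) (A : op) : op :=
  invmx (spectralmx A) *m
    diag_mx (map_mx (fun z : C => ((f (complex.Re z))%:C)%C) (spectral_diag A)) *m
    spectralmx A.

Definition mxpowR (A : op) (s : R) : op := mxfun (fun x => x `^ s) A.

Definition mxabs (A : op) : op := mxpowR (A^t* *m A) (2^-1).

(** [Phi] acts entrywise on block matrices with [m * m] blocks of size [d], that
    is as [id_m (x) Phi]. *)
Definition block_psd (m : nat) (B : 'M[op]_m) : Prop :=
  forall v : 'I_m -> 'cV[C]_d,
    0 <= \sum_(i < m) \sum_(j < m) ((v i)^t* *m B i j *m v j) 0 0.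

Definition completely_positive (Phi : op -> op) : Prop :=
  forall (m : nat) (B : 'M[op]_m), block_psd B -> block_psd (map_mx Phi B).

(** [C^o] is [C] with its usual topology. *)
Record qms (P : R -> op -> op) : Prop := QMS {
  qms_linear : forall t : R, 0 <= t -> linear (P t) ;
  qms_0 : forall X, P 0 X = X ;
  qms_D : forall (s t : R) X, 0 <= s -> 0 <= t -> P (s + t) X = P s (P t X) ;
  qms_cvg : forall X, (P t X : 'M[C^o]_d) @[t --> 0^'+] --> (X : 'M[C^o]_d) ;
  qms_cp : forall t : R, 0 <= t -> completely_positive (P t) ;
  qms_unital : forall t : R, 0 <= t -> P t 1%:M = 1%:M }.

Definition generator (P : R -> op -> op) (L : op -> op) : Prop :=
  forall X,
    ((((t^-1)%:C)%C *: (P t X - X)) : 'M[C^o]_d) @[t --> 0^'+] -->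
      (L X : 'M[C^o]_d).

Definition invariant_state (P : R -> op -> op) (tau : op) : Prop :=
  density tau /\ forall t : R, 0 <= t -> hsadj (P t) tau = tau.

Definition primitive (P : R -> op -> op) : Prop :=
  exists tau, [/\ invariant_state P tau, full_rank tau &
    forall rho, invariant_state P rho -> rho = tau].

Definition gnsdot (tau X Y : op) : C := \tr (tau *m X^t* *m Y).

Definition gns_detailed_balance (tau : op) (L : op -> op) : Prop :=
  forall X Y, gnsdot tau (L X) Y = gnsdot tau X (L Y).

Definition alicki (J : nat) (w : 'I_J -> R) (V : 'I_J -> op) (X : op) : op :=
  \sum_(j < J)
    (((expR (- w j / 2))%:C)%C *: ((V j)^t* *m commutator X (V j)) +
     ((expR (w j / 2))%:C)%C *: (commutator (V j) X *m (V j)^t*)).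

Definition Gamma (tau : op) (s : R) (X : op) : op :=
  mxpowR tau (s / 2) *m X *m mxpowR tau (s / 2).

Definition kmsdot (tau X Y : op) : C :=
  \tr (mxpowR tau (2^-1) *m X^t* *m mxpowR tau (2^-1) *m Y).

Definition wnorm (tau : op) (p : R) (X : op) : R :=
  (complex.Re (\tr (mxpowR (mxabs (Gamma tau (p^-1) X)) p))) `^ (p^-1).

Definition hconj (p : R) : R := p / (p - 1).

(** The inner product is real when [X] is Hermitian and [L] preserves
    Hermitian matrices. *)
Definition dirichlet (tau : op) (L : op -> op) (p : R) (X : op) : R :=
  - (hconj p * p / 4) *
  complex.Re (kmsdot tau
    (Gamma tau (- (hconj p)^-1) (mxpowR (Gamma tau (p^-1) X) (p - 1))) (L X)).

Definition beckner (tau : op) (L : op -> op) (p a : R) : Prop :=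
  forall X, posdef X ->
    a * hconj p * (wnorm tau p X `^ p - wnorm tau 1 X `^ p)
      <= dirichlet tau L p X.

(** The inequality is closed in [a], so a finite supremum is the largest
    constant; it is [+oo] when every constant works, as for [d = 1]. *)
Definition beckner_const (tau : op) (L : op -> op) (p : R) : \bar R :=
  ereal_sup [set a%:E | a in beckner tau L p].

Lemma hsadjP (Phi : {linear op -> op}) (X Y : op) :
  hsdot (Phi X) Y = hsdot X (hsadj Phi Y).
Proof.
rewrite {1}(matrix_sum_delta X) linear_sum /hsdot.
have tr_sum (I : finType) (F : I -> op) (B : op) :
    \tr ((\sum_i F i)^t* *m B) = \sum_i \tr ((F i)^t* *m B).
  rewrite (_ : (\sum_i F i)^t* = \sum_i (F i)^t*); last first.
    rewrite linear_sum /=.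
    exact: (raddf_sum (map_mx (Num.conj : {rmorphism C -> C}))).
  by rewrite mulmx_suml linear_sum.
rewrite tr_sum.
under eq_bigr do rewrite linear_sum tr_sum.
rewrite [RHS]/mxtrace.
under [RHS]eq_bigr do rewrite mxE.
rewrite [RHS]exchange_big /=.
apply: eq_bigr => i _; apply: eq_bigr => j _.
rewrite linearZ /= linearZ /= map_mxZ -scalemxAl linearZ /= !mxE.
by rewrite /hsdot.
Qed.

End Operators.

(* Main.v *)
Require Import Defs.
From HB Require Import structures.
From mathcomp Require Import all_boot all_order all_algebra.
From mathcomp Require Import complex.
From mathcomp Require Import all_classical all_reals all_analysis.
From mathcomp Require Import measurable_realfun ring lra.

Set Implicit Arguments.
Unset Strict Implicit.
Unset Printing Implicit Defensive.

Import Order.TTheory GRing.Theory Num.Theory.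
Import numFieldNormedType.Exports.

Local Open Scope classical_set_scope.
Local Open Scope ring_scope.
Local Open Scope sesquilinear_scope.

(** The two functionals of the Beckner inequality are compared at one and the same
    [X]: if [E] is the Dirichlet form and [D(X) = ||X||_p^p - ||X||_1^p], then
    [D_sigma <= Lmax D_sigma'] and [Lmin m E_sigma' <= E_sigma], and an admissible
    constant for [sigma'] becomes one for [sigma] after multiplication by
    [Lmin m / Lmax] ([beckner_transfer]).  Put [a = 1/(2p)] and
    [Y = sigma^a X sigma^a], so that [||X||_p^p = Tr Y^p].

    The functional [D].  For a weight [tau] diagonal in the common basis, let
    [x_k] be the diagonal coefficients of [X].  Then
    [Tr (tau^a X tau^a)^p - sum_k tau_k x_k^p] is nondecreasing in [tau]
    ([powtr_sandwich_mono]): with [Y = tau^a X tau^a], its derivative in [tau_k] is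
    [(Y^p)_kk / tau_k - x_k^p], which is nonnegative by Jensen's inequality
    because [Y_kk = tau_k^(1/p) x_k].  Klein's trace inequality replaces the
    derivative.  The comparison of [sigma] with [Lmax sigma'], together with the
    tangent of [x^p] at [Tr sigma' X], gives the bound on [D_sigma]
    ([beckner_var_le]).

    The Dirichlet form.  Each [V = V_j] commutes up to scalars with the powers of
    [sigma], which turns the corresponding term of [E_sigma] into
    [sum_kl |V_kl|^2 (A_l^(p-1) - B_k^(p-1)) (A_l - B_k)], the coefficients being
    taken in an eigenbasis of [Y], with [A = exp(-a omega) Y] and
    [B = exp(a omega) Y] ([dirichlet_term]).  The matrix [T = V A - B V] is
    [sigma^a [V, X] sigma^a]; hence the passage from [sigma] to [sigma'] replaces
    [Y] and [T] by [M Y M] and [M T M], where [M = (sigma'/sigma)^a].  As [x^(p-1)]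
    is an integral of functions [x / (x + t)], it suffices to compare the traces of
    [(B + t)^-1 T (A + t)^-1 T^*] ([power_difference_of_resolvents]).  There the
    outer factors [M] enter the resolvents, [M (M B M + t)^-1 M = (B + t M^-2)^-1],
    and the inverse is antitone ([tr_resolvent_le]).  The exponentials of [omega]
    and [nu] differ by factors at least [exp(-a |omega - nu|)], which
    homogeneity of degree [p - 2] raises to the power [2 - p]
    ([twisted_deriv_form_le]). *)

(** * Powers as integrals of resolvents *)

Section PowerOfResolvents.
Variable R : realType.
Local Notation mu := (@lebesgue_measure R).
Local Notation pos_half := (`[0, +oo[%classic : set R).

Definition resolvent_kernel (r x u : R) : R := x / (x + u `^ r).

Lemma resolvent_kernel_ge0 (r x u : R) : 0 < x -> 0 <= resolvent_kernel r x u.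
Proof. by move=> x0; rewrite divr_ge0 ?addr_ge0 ?powR_ge0 // ltW. Qed.

Lemma within_continuous_resolvent_kernel (r x : R) : 0 < r -> 0 < x ->
  {within `[0, +oo[, continuous (resolvent_kernel r x)}.
Proof.
move=> r0 x0; apply/continuous_within_itvcyP; split=> [u|].
  rewrite in_itv/= andbT => u0.
  apply: cvgM; first exact: cvg_cst.
  apply: cvgV; first by rewrite gt_eqF // addr_gt0 // powR_gt0.
  apply: cvgD; first exact: cvg_cst.
  have := @is_derive1_powR R r u u0.
  by move=> /@ex_derive /derivable1_diffP /differentiable_continuous.
rewrite /resolvent_kernel powR0 ?gt_eqF // addr0.
apply: cvgM; first exact: cvg_cst.
apply: cvgV; first by rewrite gt_eqF.
by rewrite -{2}[x]addr0; apply: cvgD; [exact: cvg_cst|exact: powR_cvg0].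
Qed.

Lemma measurable_resolvent_kernel (r x : R) : 0 < r -> 0 < x ->
  measurable_fun pos_half (resolvent_kernel r x).
Proof.
move=> r0 x0; apply: subspace_continuous_measurable_fun => //.
exact: within_continuous_resolvent_kernel.
Qed.

(** Homogeneity, by the substitution [u = x^(1/r) w]. *)
Lemma integral_resolvent_kernel (r x : R) : 0 < r -> 0 < x ->
  (\int[mu]_(u in pos_half) (resolvent_kernel r x u)%:E =
   (x `^ r^-1)%:E * \int[mu]_(u in pos_half) (resolvent_kernel r 1 u)%:E)%E.
Proof.
move=> r0 x0; set c := x `^ r^-1.
have c0 : 0 < c by exact: powR_gt0.
have dF (y : R) : is_derive y 1 ( *%R c) c.
  by apply: is_derive_eq; rewrite scaler1 ?mulr1 //.
have dF1 : derive1 ( *%R c) = cst c.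
  by apply/funext => y; rewrite derive1E; exact: derive_val.
have := @increasing_ge0_integration_by_substitutiony R ( *%R c)
  (resolvent_kernel r x) 0.
rewrite mulr0 dF1 => ->.
- rewrite -ge0_integralZl_EFin //=.
  + apply: eq_integral => u; rewrite inE/= in_itv/= andbT => u0.
    rewrite -EFinM; congr (_%:E).
    transitivity (resolvent_kernel r x (c * u) * c); first by [].
    rewrite /resolvent_kernel powRM ?(ltW c0) // -powRrM mulVf ?gt_eqF //.
    rewrite powRr1 ?(ltW x0) //.
    have ur : 0 < 1 + u `^ r by rewrite ltr_wpDr ?powR_ge0.
    by field; rewrite !gt_eqF //= -[X in X + _]mulr1 -mulrDr mulr_gt0.
  + by move=> u _; rewrite lee_fin; exact: resolvent_kernel_ge0.
  + by apply/measurable_EFinP; exact: measurable_resolvent_kernel.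
  + exact: ltW.
- by move=> y z _ _ yz; rewrite ltr_pM2l.
- by move=> y _; exact: cvg_cst.
- exact: is_cvg_cst.
- exact: is_cvg_cst.
- split; first by move=> y _; exact: ex_derive.
  rewrite mulr0; apply: cvg_at_right_filter.
  rewrite -[X in _ --> X](mulr0 c); apply: cvgM; [exact: cvg_cst|exact: cvg_id].
- exact: gt0_cvgMry.
- exact: within_continuous_resolvent_kernel.
- by move=> u _; exact: resolvent_kernel_ge0.
Qed.

(** A majorant of the kernel with an elementary primitive. *)
Lemma integral_powR_tail (r : R) : 1 < r ->
  (\int[mu]_(u in pos_half) ((1 + u) `^ (- r))%:E = ((r - 1)^-1)%:E)%E.
Proof.
move=> r1.
pose F (u : R) := - (r - 1)^-1 * (1 + u) `^ (1 - r).
have r10 : 0 < r - 1 by rewrite subr_gt0.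
have dF (u : R) : 0 <= u -> is_derive u 1 F ((1 + u) `^ (- r)).
  move=> u0; have u1 : 0 < 1 + u by rewrite ltr_wpDr.
  have h1 : is_derive u 1 (fun v : R => 1 + v) 1.
    by have := is_deriveD (is_derive_cst (1 : R) u 1) (is_derive_id u 1); rewrite add0r.
  have := @is_derive1_comp _ (@powR R ^~ (1 - r)) (fun v : R => 1 + v) u _ _
    (@is_derive1_powR R _ _ u1) h1.
  move=> h2; rewrite /F; apply: is_derive_eq.
  rewrite /= /GRing.scale /= ?mulr1 ?mulr0 ?addr0.
  rewrite (_ : 1 - r - 1 = - r); last by ring.
  by field; rewrite gt_eqF.
have cF (u : R) : 0 <= u -> F v @[v --> u] --> F u.
  move=> u0; have := dF u u0.
  by move=> /@ex_derive /derivable1_diffP /differentiable_continuous.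
rewrite (@ge0_continuous_FTC2y _ _ F 0 0).
- by rewrite /F addr0 powR1 mulr1 -EFinB sub0r opprK.
- by move=> u u0; exact: powR_ge0.
- apply/continuous_within_itvcyP.
  have h (u : R) : 0 <= u -> (fun v : R => (1 + v) `^ (- r)) v @[v --> u] -->
      (1 + u) `^ (- r).
    move=> u0; have u1 : 0 < 1 + u by rewrite ltr_wpDr.
    have h1 : is_derive u 1 (fun v : R => 1 + v) 1.
      by have := is_deriveD (is_derive_cst (1 : R) u 1) (is_derive_id u 1); rewrite add0r.
    have := @is_derive1_comp _ (@powR R ^~ (- r)) (fun v : R => 1 + v) u _ _
      (@is_derive1_powR R _ _ u1) h1.
    by move=> /@ex_derive /derivable1_diffP /differentiable_continuous.
  split=> [u|]; first by rewrite in_itv/= andbT => /ltW; exact: h.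
  by apply: cvg_at_right_filter; exact: h.
- rewrite -[X in _ --> X](mulr0 (- (r - 1)^-1)).
  apply: cvgM; first exact: cvg_cst.
  have -> : (fun u : R => (1 + u) `^ (1 - r)) =
      (fun u : R => ((1 + u) `^ (r - 1))^-1).
    by apply/funext => u; rewrite -powRN opprB.
  apply/gtr0_cvgV0; first by near=> u; rewrite powR_gt0 // ltr_pwDl.
  apply/cvgryPge => A.
  near=> u.
  have A1 : (Num.max A 1) = (Num.max A 1 `^ ((r - 1)^-1)) `^ (r - 1).
    by rewrite -powRrM mulVf ?gt_eqF // powRr1 // le_max ler01 orbT.
  apply: (@le_trans _ _ (Num.max A 1)); first by rewrite le_max lexx.
  rewrite A1; apply: ge0_ler_powR => //; first exact: ltW.
  + by rewrite nnegrE powR_ge0.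
  + by rewrite nnegrE addr_ge0.
  + apply: (@le_trans _ _ u); last by rewrite lerDr.
    by near: u; exact: nbhs_pinfty_ge.
- by move=> u /ltW u0; have := dF u u0 => /@ex_derive.
- by apply: cvg_at_right_filter; exact: cF.
- move=> u; rewrite in_itv/= andbT => /ltW u0; rewrite derive1E.
  by have := dF u u0 => /@derive_val.
Unshelve. all: by end_near. Qed.

Lemma resolvent_kernel_le (r u : R) : 0 < r -> 0 <= u ->
  resolvent_kernel r 1 u <= 2 `^ r * (1 + u) `^ (- r).
Proof.
move=> r0 u0; have u1 : 0 < 1 + u by rewrite ltr_pwDl.
rewrite /resolvent_kernel powRN ler_pdivrMr ?ltr_pwDl ?powR_ge0 //.
rewrite mulrAC ler_pdivlMr ?powR_gt0 // mul1r.
have [h|h] := leP u 1.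
  apply: (@le_trans _ _ (2 `^ r)).
    by apply: ge0_ler_powR; rewrite ?nnegrE; lra.
  by rewrite ler_peMr ?powR_ge0 // lerDl powR_ge0.
apply: (@le_trans _ _ (2 `^ r * u `^ r)).
  rewrite -powRM //; apply: ge0_ler_powR; rewrite ?nnegrE; lra.
by rewrite ler_wpM2l ?powR_ge0 // lerDr.
Qed.

Lemma measurable_shifted_powR (s : R) :
  measurable_fun pos_half (fun u : R => (1 + u) `^ s).
Proof.
apply: measurable_funTS.
have : measurable_fun setT (fun u : R => 1 + u) by exact: measurable_funD.
exact: (measurableT_comp (@measurable_powR R s)).
Qed.

Lemma integrable_resolvent_kernel1 (r : R) : 1 < r ->
  mu.-integrable pos_half (EFin \o resolvent_kernel r 1).
Proof.
move=> r1; have r0 : 0 < r by exact: lt_trans r1.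
have mk := @measurable_resolvent_kernel r 1 r0 ltr01.
apply/integrableP; split; first exact/measurable_EFinP.
apply: (@le_lt_trans _ _
  (\int[mu]_(u in pos_half) ((2 `^ r)%:E * ((1 + u) `^ (- r))%:E))%E).
  apply: ge0_le_integral => //=.
  - apply/measurable_EFinP; apply: (measurableT_comp (normr_measurable (D := setT)) mk).
  - have /measurable_EFinP // : measurable_fun pos_half
        (fun u : R => 2 `^ r * (1 + u) `^ (- r)).
    by apply: measurable_funM => //; exact: measurable_shifted_powR.
  - move=> u; rewrite /= in_itv/= andbT => u0.
    rewrite -EFinM lee_fin ger0_norm; last exact: resolvent_kernel_ge0.
    exact: resolvent_kernel_le.
rewrite ge0_integralZl_EFin //.
- by rewrite integral_powR_tail // -EFinM ltry.
- by move=> u _; rewrite lee_fin powR_ge0.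
- by apply/measurable_EFinP; exact: measurable_shifted_powR.
Qed.

Lemma integral_resolvent_kernel1_gt0 (r : R) : 0 < r ->
  (0 < \int[mu]_(u in pos_half) (resolvent_kernel r 1 u)%:E)%E.
Proof.
move=> r0.
pose unit_itv : set R := `[0, 1]%classic; pose half : R := 2^-1.
apply: (@lt_le_trans _ _ (\int[mu]_(u in unit_itv) half%:E)%E).
  rewrite integral_cst /unit_itv; last exact: measurable_itv.
  rewrite /= lebesgue_measure_itv /= lte_fin ltr01 sube0.
  by rewrite mule1 lte_fin invr_gt0.
have sub : unit_itv `<=` pos_half.
  by move=> u; rewrite /= !in_itv /= andbT => /andP[].
apply: (@le_trans _ _
  (\int[mu]_(u in unit_itv) (resolvent_kernel r 1 u)%:E)%E).
  apply: ge0_le_integral => //=.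
  - exact: measurable_itv.
  - by move=> u _; rewrite lee_fin invr_ge0.
  - apply/measurable_EFinP.
    have mk := measurable_resolvent_kernel r0 ltr01.
    by apply: (measurable_funS _ sub mk); exact: measurable_itv.
  - move=> u; rewrite /unit_itv /= in_itv /= => /andP[u0 u1]; rewrite lee_fin.
    rewrite /resolvent_kernel ler_pdivlMr ?ltr_pwDl ?powR_ge0 //.
    suff : u `^ r <= 1 by rewrite /half; lra.
    have -> : (1 : R) = 1 `^ r by rewrite powR1.
    by apply: ge0_ler_powR; rewrite ?nnegrE //; exact: ltW.
apply: ge0_subset_integral => //.
- exact: measurable_itv.
- by apply/measurable_EFinP; exact: measurable_resolvent_kernel.
- by move=> u _; rewrite lee_fin; exact: resolvent_kernel_ge0.
Qed.

(** For [q < 1] the power [x `^ q] is, up to a positive constant, the integral of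
    [x / (x + u `^ q^-1)] over [u >= 0]; with [t = u `^ q^-1] in place of [t] as the
    variable of integration the integrand stays bounded at [0].  For [q = 1] that
    integral diverges, but [t * (x / (x + t))] tends to [x] as [t] grows.
    Coefficients of both signs are allowed, so the lemma transfers inequalities
    between resolvent sums to inequalities between power sums. *)
Lemma power_of_resolvents (I : finType) (al x : I -> R) (q : R) :
  0 < q -> q <= 1 -> (forall i, 0 < x i) ->
  (forall t, 0 <= t -> 0 <= \sum_i al i * (x i / (x i + t))) ->
  0 <= \sum_i al i * x i `^ q.
Proof.
move=> q0; rewrite le_eqVlt => /predU1P[-> | q1] x0 H.
  under eq_bigr do rewrite powRr1 ?(ltW (x0 _)) //.
  (* [x - t x / (x + t) = x^2 / (x + t) <= x^2 / t]: the error is at most [B / t]. *)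
  set S := \sum_i _; set B := \sum_i `|al i| * (x i) ^+ 2.
  have B0 : 0 <= B by apply: sumr_ge0 => i _; rewrite mulr_ge0 // sqr_ge0.
  have SB (t : R) : 0 < t -> - B <= t * S.
    move=> t0; have := H t (ltW t0).
    rewrite -(pmulr_rge0 _ t0) mulr_sumr => {}H.
    have : \sum_i t * (al i * (x i / (x i + t))) <= S + B / t.
      rewrite /B mulr_suml -big_split /=; apply: ler_sum => i _.
      have xt : 0 < x i + t by rewrite addr_gt0.
      rewrite -subr_ge0.
      rewrite (_ : _ - _ = (al i + `|al i|) * (x i ^+ 2 / (x i + t)) +
         `|al i| * (x i ^+ 3 / (t * (x i + t)))); last first.
        by field; rewrite !gt_eqF.
      rewrite addr_ge0 // mulr_ge0 //.
      - by have := ler_norm (- al i); rewrite normrN; lra.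
      - by rewrite divr_ge0 ?sqr_ge0 // ltW.
      - by rewrite divr_ge0 ?exprn_ge0 ?mulr_ge0 // ltW.
    move=> h; have : 0 <= S + B / t by exact: le_trans h.
    by rewrite -(pmulr_rge0 _ t0) mulrDr mulrCA divff ?gt_eqF // mulr1; lra.
  rewrite leNgt; apply/negP => S0.
  (* at this value of [t] the bound reads [- B <= - (B + 1)] *)
  have := SB ((B + 1) / - S); rewrite divr_gt0 ?oppr_gt0 //; last lra.
  move=> /(_ erefl); rewrite (_ : _ * S = - (B + 1)); first lra.
  by field; rewrite lt_eqF.
have r1 : 1 < q^-1 by rewrite invf_gt1.
have r0 : 0 < q^-1 by rewrite invr_gt0.
set c := (\int[mu]_(u in pos_half) (resolvent_kernel q^-1 1 u)%:E)%E.
have cfin : c \is a fin_num.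
  apply: integrable_fin_num => //; exact: (integrable_resolvent_kernel1 r1).
have c0 : 0 < fine c.
  rewrite fine_gt0 // integral_resolvent_kernel1_gt0 //=.
  by rewrite ltey_eq cfin.
have kint i : mu.-integrable pos_half (EFin \o resolvent_kernel q^-1 (x i)).
  apply/integrableP; split.
    by apply/measurable_EFinP; exact: measurable_resolvent_kernel.
  under eq_integral.
    move=> u _; rewrite /= ger0_norm; last exact: resolvent_kernel_ge0.
    over.
  rewrite integral_resolvent_kernel // -/c -(fineK cfin) -EFinM ltry //.
rewrite -(pmulr_rge0 _ c0) mulr_sumr -lee_fin -sumEFin.
rewrite (eq_bigr (fun i => (\int[mu]_(u in pos_half)
    ((al i)%:E * (resolvent_kernel q^-1 (x i) u)%:E)%E)%E)); last first.
  move=> i _; rewrite integralZl //; last exact: kint.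
  rewrite integral_resolvent_kernel // invrK -/c -[X in (_ * (_ * X))%E](fineK cfin).
  by rewrite -!EFinM; congr (_%:E); ring.
rewrite -integral_sum //; last first.
  by move=> i; apply: integrableZl => //; exact: kint.
apply: integral_ge0 => u _.
under eq_bigr do rewrite -EFinM.
by rewrite sumEFin lee_fin; apply: H; exact: powR_ge0.
Qed.

(** For [f x = x / (x + t)] the product [(f x - f y) * (x - y)] equals
    [t * (x - y) ^+ 2 / ((x + t) * (y + t))]. *)
Lemma power_difference_of_resolvents (I : finType) (w x y : I -> R) (q : R) :
  0 < q -> q <= 1 -> (forall i, 0 < x i) -> (forall i, 0 < y i) ->
  (forall t, 0 <= t ->
     0 <= \sum_i w i * (t * (x i - y i) ^+ 2 / ((x i + t) * (y i + t)))) ->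
  0 <= \sum_i w i * ((x i `^ q - y i `^ q) * (x i - y i)).
Proof.
move=> q0 q1 x0 y0 H.
pose al (k : I + I) := match k with
  | inl i => w i * (x i - y i) | inr i => - (w i * (x i - y i)) end.
pose z (k : I + I) := match k with inl i => x i | inr i => y i end.
have z0 k : 0 < z k by case: k => i /=.
have E : \sum_i w i * ((x i `^ q - y i `^ q) * (x i - y i)) =
    \sum_k al k * z k `^ q.
  by rewrite big_sumType /= -big_split /=; apply: eq_bigr => i _; ring.
rewrite E; apply: power_of_resolvents => // t t0; have := H t t0; congr (0 <= _).
rewrite big_sumType /= -big_split /=; apply: eq_bigr => i _.
by field; rewrite !gt_eqF // ltr_wpDr.
Qed.

End PowerOfResolvents.

(** * Hermitian matrices in diagonal form *)

(** Locked, since hermitian matrices are compared through their spectra and never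
    through the products that define them. *)
HB.lock Definition hdiag (R : realType) (C : numClosedFieldType)
    (cplx : {rmorphism R -> C}) (n : nat) (U : 'M[C]_n) (s : 'I_n -> R) : 'M[C]_n :=
  U^t* *m diag_mx (\row_i cplx (s i)) *m U.

(** [C] stands for the complex numbers; the three hypotheses on the embedding of
    the reals and on the real part are all that the matrix algebra depends on. *)
Section Matrices.
Variables (R : realType) (C : numClosedFieldType).
Variables (cplx : {rmorphism R -> C}) (re : C -> R).
Hypothesis cplx_ge0 : forall x, (0 <= cplx x) = (0 <= x).
Hypothesis cplxK : cancel cplx re.
Hypothesis reK : {in Num.real, cancel re cplx}.

Lemma cplx_real (a : R) : cplx a \is Num.real.
Proof.
by rewrite realE -oppr_ge0 -rmorphN !cplx_ge0 oppr_ge0; exact: num_real.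
Qed.

Lemma conj_cplx (a : R) : (cplx a)^* = cplx a.
Proof. exact/CrealP/cplx_real. Qed.

Lemma cplx_gt0 (a : R) : (0 < cplx a) = (0 < a).
Proof. by rewrite !lt0r cplx_ge0 fmorph_eq0. Qed.

Definition sqnorm (z : C) : R := re (z * z^*).

Lemma sqnormE (z : C) : cplx (sqnorm z) = z * z^*.
Proof. by rewrite reK // ger0_real // mul_conjC_ge0. Qed.

Lemma sqnorm_ge0 (z : C) : 0 <= sqnorm z.
Proof. by rewrite -cplx_ge0 sqnormE mul_conjC_ge0. Qed.

Lemma sqnormZ (a : R) (z : C) : sqnorm (cplx a * z) = a ^+ 2 * sqnorm z.
Proof.
apply: (fmorph_inj cplx).
rewrite rmorphM rmorphXn /= !sqnormE rmorphM /= conj_cplx.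
by rewrite mulrACA -expr2.
Qed.

Lemma trmxC_mul m n p (A : 'M[C]_(m, n)) (B : 'M[C]_(n, p)) :
  (A *m B)^t* = B^t* *m A^t*.
Proof. by rewrite trmx_mul map_mxM. Qed.

Lemma trmxCD m n (A B : 'M[C]_(m, n)) : (A + B)^t* = A^t* + B^t*.
Proof. by rewrite linearD /= map_mxD. Qed.

Lemma trmxCN m n (A : 'M[C]_(m, n)) : (- A)^t* = - A^t*.
Proof. by rewrite linearN /= map_mxN. Qed.

Lemma trmxCZ m n (a : C) (A : 'M[C]_(m, n)) : (a *: A)^t* = a^* *: A^t*.
Proof. by rewrite linearZ /= map_mxZ. Qed.

Lemma trmxC1 n : (1%:M : 'M[C]_n)^t* = 1%:M.
Proof. by rewrite trmx1 map_mx1. Qed.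

Variable n : nat.
Local Notation op := 'M[C]_n.
Implicit Types (U W T A B : op) (s t : 'I_n -> R).

Lemma unitarymx_mulVmx U : U \is unitarymx -> U^t* *m U = 1%:M.
Proof. by move=> /unitarymxP /mulmx1C. Qed.

Definition cdiag s : op := diag_mx (\row_i cplx (s i)).

Lemma cdiagM s t : cdiag s *m cdiag t = cdiag (fun i => s i * t i).
Proof.
by rewrite mulmx_diag; congr diag_mx; apply/rowP => i; rewrite !mxE rmorphM.
Qed.

Lemma trmxC_cdiag s : (cdiag s)^t* = cdiag s.
Proof.
apply/matrixP => i j; rewrite !mxE; have [->|_] := eqVneq i j.
  by rewrite !mulr1n conj_cplx.
by rewrite !mulr0n conjC0.
Qed.

Local Notation hdiag := (hdiag cplx).

Lemma hdiagE U s : hdiag U s = U^t* *m cdiag s *m U.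
Proof. by rewrite hdiag.unlock. Qed.

Lemma trmxC_hdiag U s : (hdiag U s)^t* = hdiag U s.
Proof. by rewrite !hdiagE !trmxC_mul trmxCK trmxC_cdiag mulmxA. Qed.

Lemma hdiagM U s t : U \is unitarymx ->
  hdiag U s *m hdiag U t = hdiag U (fun i => s i * t i).
Proof. by move=> uU; rewrite !hdiagE -(cdiagM s t) !mulmxA (mulmxtVK _ uU). Qed.

Lemma eq_hdiag U s t : s =1 t -> hdiag U s = hdiag U t.
Proof. by move=> /funext ->. Qed.

Lemma hdiag1 U : U \is unitarymx -> hdiag U (fun=> 1) = 1%:M.
Proof.
move=> uU; rewrite !hdiagE (_ : cdiag _ = 1%:M) ?mulmx1 ?unitarymx_mulVmx //.
by apply/matrixP => i j; rewrite !mxE rmorph1.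
Qed.

Lemma hdiagD U s t : hdiag U s + hdiag U t = hdiag U (fun i => s i + t i).
Proof.
rewrite !hdiagE; suff -> : cdiag (fun i => s i + t i) = cdiag s + cdiag t.
  by rewrite mulmxDr mulmxDl.
by apply/matrixP => i j; rewrite !mxE rmorphD mulrnDl.
Qed.

Lemma hdiagZ U (a : R) s : cplx a *: hdiag U s = hdiag U (fun i => a * s i).
Proof.
rewrite !hdiagE; suff -> : cdiag (fun i => a * s i) = cplx a *: cdiag s.
  by rewrite -scalemxAr -scalemxAl.
by apply/matrixP => i j; rewrite !mxE rmorphM mulrnAr.
Qed.

Lemma tr_hdiag U s : U \is unitarymx -> \tr (hdiag U s) = cplx (\sum_i s i).
Proof.
move=> uU; rewrite !hdiagE mxtrace_mulC mulmxA (unitarymxP uU) mul1mx.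
rewrite mxtrace_diag rmorph_sum.
by apply: eq_bigr => i _; rewrite mxE.
Qed.

Lemma tr_cdiag_form (s t : 'I_n -> R) (Q : op) :
  \tr (cdiag s *m Q *m cdiag t *m Q^t*) =
  cplx (\sum_k \sum_l s k * t l * sqnorm (Q k l)).
Proof.
rewrite /mxtrace rmorph_sum; apply: eq_bigr => k _.
rewrite mxE rmorph_sum; apply: eq_bigr => l _.
rewrite !rmorphM /= sqnormE /cdiag mul_mx_diag mul_diag_mx !mxE.
by rewrite !mulrA; congr (_ * _); rewrite mulrAC.
Qed.

(** Every trace below is of this shape: two matrices diagonalized in different
    bases, coupled by the squared moduli of the coefficients of [T]. *)
Lemma tr_hdiag_form U W s t T : U \is unitarymx -> W \is unitarymx ->
  \tr (hdiag U s *m T *m hdiag W t *m T^t*) =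
  cplx (\sum_k \sum_l s k * t l * sqnorm ((U *m T *m W^t*) k l)).
Proof.
move=> uU uW; rewrite -tr_cdiag_form !hdiagE -!mulmxA mxtrace_mulC.
by rewrite !trmxC_mul trmxCK !mulmxA.
Qed.

Lemma sqnorm_unitary_row U k : U \is unitarymx -> \sum_l sqnorm (U k l) = 1.
Proof.
move=> /unitarymxP /matrixP /(_ k k); rewrite !mxE eqxx mulr1n => E.
apply: (fmorph_inj cplx); rewrite rmorph_sum rmorph1 -E.
by apply: eq_bigr => l _; rewrite sqnormE !mxE.
Qed.

Lemma sqnorm_conj (z : C) : sqnorm z^* = sqnorm z.
Proof. by rewrite /sqnorm conjCK mulrC. Qed.

Lemma sqnorm_unitary_col U l : U \is unitarymx -> \sum_k sqnorm (U k l) = 1.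
Proof.
rewrite -trmxC_unitary => /(@sqnorm_unitary_row _ l) <-.
by apply: eq_bigr => k _; rewrite !mxE sqnorm_conj.
Qed.

(** * Positivity *)

Definition nonneg_form A : Prop :=
  forall v : 'cV[C]_n, 0 <= (v^t* *m A *m v) 0 0.

Definition pos_form A : Prop :=
  forall v : 'cV[C]_n, v != 0 -> 0 < (v^t* *m A *m v) 0 0.

Lemma quad_hdiag U s (v : 'cV[C]_n) :
  (v^t* *m hdiag U s *m v) 0 0 = cplx (\sum_k s k * sqnorm ((U *m v) k 0)).
Proof.
have -> : v^t* *m hdiag U s *m v = (U *m v)^t* *m (cdiag s *m (U *m v)).
  by rewrite !hdiagE trmxC_mul !mulmxA.
rewrite mxE rmorph_sum; apply: eq_bigr => k _.
rewrite /cdiag mul_diag_mx !mxE rmorphM /= sqnormE mulrCA.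
by rewrite [_^* * _]mulrC.
Qed.

Lemma nonneg_form_hdiag U s : (forall i, 0 <= s i) -> nonneg_form (hdiag U s).
Proof.
move=> s0 v; rewrite quad_hdiag cplx_ge0.
by apply: sumr_ge0 => k _; rewrite mulr_ge0 ?sqnorm_ge0.
Qed.

Lemma nonneg_formD A B : nonneg_form A -> nonneg_form B -> nonneg_form (A + B).
Proof. by move=> pA pB v; rewrite mulmxDr mulmxDl mxE addr_ge0. Qed.

Lemma nonneg_form_congr A T : nonneg_form A -> nonneg_form (T^t* *m A *m T).
Proof. by move=> pA v; have := pA (T *m v); rewrite trmxC_mul !mulmxA. Qed.

Lemma tr_nonneg_hdiag A U s T : nonneg_form A -> (forall i, 0 <= s i) ->
  0 <= \tr (A *m T *m hdiag U s *m T^t*).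
Proof.
move=> pA s0; pose Q := T *m U^t*.
have -> : A *m T *m hdiag U s *m T^t* = A *m Q *m (cdiag s *m Q^t*).
  by rewrite /Q !hdiagE trmxC_mul trmxCK !mulmxA.
rewrite mxtrace_mulC -mulmxA /cdiag /mxtrace.
apply: sumr_ge0 => l _; rewrite mul_diag_mx !mxE mulr_ge0 ?cplx_ge0 //.
have := pA (col l Q); congr (0 <= _).
rewrite -mulmxA; rewrite !mxE; apply: eq_bigr => i _; rewrite !mxE; congr (_ * _).
by apply: eq_bigr => j _; rewrite !mxE.
Qed.

(** The inverse is antitone: for [D = A - B],
    [B^-1 - A^-1 = A^-1 D A^-1 + A^-1 D B^-1 D A^-1]. *)
Lemma nonneg_form_inv A B A' B' : A *m A' = 1%:M -> B *m B' = 1%:M ->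
  A^t* = A -> A'^t* = A' -> B^t* = B ->
  nonneg_form (A - B) -> nonneg_form B' -> nonneg_form (B' - A').
Proof.
move=> AA' BB' hA hA' hB pD pB'.
have A'A : A' *m A = 1%:M by exact: mulmx1C.
have B'B : B' *m B = 1%:M by exact: mulmx1C.
set D := A - B in pD *.
have hD : D^t* = D by rewrite /D trmxCD trmxCN hA hB.
have -> : B' - A' = A'^t* *m D *m A' + (D *m A')^t* *m B' *m (D *m A').
  rewrite trmxC_mul hD hA'.
  have DA' : D *m A' = 1%:M - B *m A' by rewrite /D mulmxBl AA'.
  have A'D : A' *m D = 1%:M - A' *m B by rewrite /D mulmxBr A'A.
  have B'D : B' *m (D *m A') = B' - A'.
    by rewrite DA' mulmxBr mulmx1 mulmxA B'B mul1mx.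
  rewrite -[A' *m D *m B' *m _]mulmxA B'D -mulmxDr.
  rewrite [A' + _]addrC subrK A'D mulmxBl mul1mx.
  have -> : A' *m B *m B' = A' by rewrite -mulmxA BB' mulmx1.
  by [].
by apply: nonneg_formD; apply: nonneg_form_congr.
Qed.

(** * Functional calculus *)

(** Entrywise, since [s i = t j] wherever [Q i j] is nonzero. *)
Lemma cdiag_intertwine (f : R -> R) (Q : op) s t :
  cdiag s *m Q = Q *m cdiag t ->
  cdiag (f \o s) *m Q = Q *m cdiag (f \o t).
Proof.
move=> /matrixP E; apply/matrixP => i j; move: (E i j).
rewrite /cdiag !mul_diag_mx !mul_mx_diag !mxE /= [cplx (s i) * _]mulrC => /eqP.
rewrite -subr_eq0 -mulrBr mulf_eq0 subr_eq0.
case/orP => [/eqP ->|/eqP /fmorph_inj ->]; last by rewrite mulrC.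
by rewrite mulr0 mul0r.
Qed.

Lemma hermitian_spectral A : A^t* = A ->
  exists2 U, U \is unitarymx & exists2 z : 'rV[C]_n,
    A = U^t* *m diag_mx z *m U & spectralmx A = U /\ spectral_diag A = z.
Proof.
move=> hA; exists (spectralmx A); first exact: spectral_unitarymx.
exists (spectral_diag A) => //.
have nA : A \is normalmx by apply/normalmxP; rewrite hA.
have /orthomx_spectralP E := nA.
by rewrite -invmx_unitary ?spectral_unitarymx.
Qed.

(** The columns of [U^t*] are unit eigenvectors. *)
Lemma diag_mx_quad U (z : 'rV[C]_n) k : U \is unitarymx ->
  ((U^t* *m (delta_mx k 0 : 'cV[C]_n))^t* *m (U^t* *m diag_mx z *m U) *m
     (U^t* *m (delta_mx k 0 : 'cV[C]_n))) 0 0 = z 0 k.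
Proof.
move=> uU; rewrite trmxC_mul trmxCK !mulmxA !mulmxtVK //.
rewrite -mulmxA mul_diag_mx mxE (bigD1 k) //= !mxE !eqxx /= conjC1 mul1r mulr1.
by rewrite big1 ?addr0 // => i /negPf ik; rewrite !mxE ik /= conjC0 mul0r.
Qed.

(** A skew-hermitian matrix is normal and its eigenvalues are values of its
    quadratic form. *)
Lemma skew_hermitian_eq0 A : A^t* = - A ->
  (forall v : 'cV[C]_n, (v^t* *m A *m v) 0 0 = 0) -> A = 0.
Proof.
move=> hA H.
have nA : A \is normalmx by apply/normalmxP; rewrite hA mulmxN mulNmx.
have /orthomx_spectralP E := nA.
rewrite invmx_unitary ?spectral_unitarymx // in E.
rewrite E; set U := spectralmx A in E *; set z := spectral_diag A in E *.
have uU : U \is unitarymx by exact: spectral_unitarymx.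
suff -> : z = 0 by rewrite (_ : diag_mx 0 = 0) ?mulmx0 ?mul0mx // linear0.
apply/rowP => k; rewrite -(diag_mx_quad z k uU) -E H mxE.
by [].
Qed.

Lemma real_form_hermitian A :
  (forall v : 'cV[C]_n, (v^t* *m A *m v) 0 0 \is Num.real) -> A^t* = A.
Proof.
move=> rA; apply/eqP; rewrite -subr_eq0; apply/eqP/skew_hermitian_eq0.
  by rewrite trmxCD trmxCN trmxCK opprB.
move=> v; have -> : v^t* *m (A^t* - A) *m v = (v^t* *m A *m v)^t* - v^t* *m A *m v.
  by rewrite mulmxBr mulmxBl !trmxC_mul trmxCK !mulmxA.
by rewrite !mxE; have /CrealP := rA v; rewrite !mxE => ->; rewrite subrr.
Qed.

(** A complex matrix with a positive quadratic form is Hermitian, and its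
    eigenvalues are values of the form. *)
Lemma pos_form_spectral A : pos_form A ->
  exists2 U, U \is unitarymx & exists2 y : 'I_n -> R,
    (forall k, 0 < y k) & A = hdiag U y.
Proof.
move=> pA; have hA : A^t* = A.
  apply: real_form_hermitian => v; apply: ger0_real.
  have [->|/pA /ltW //] := eqVneq v 0.
  by rewrite mulmx0 mxE.
have [U uU [z E _]] := hermitian_spectral hA.
have z0 k : 0 < z 0 k.
  rewrite -(diag_mx_quad z k uU) -E; apply: pA.
  apply/eqP => /(congr1 (mulmx U)); rewrite mulmxA (unitarymxP uU) mul1mx mulmx0.
  move=> /matrixP /(_ k 0); rewrite !mxE !eqxx => /eqP; apply/negP.
  exact: oner_neq0.
have zE k : z 0 k = cplx (re (z 0 k)) by rewrite reK // gtr0_real.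
exists U => //; exists (fun k => re (z 0 k)) => [k|].
  by rewrite -cplx_gt0 -zE.
rewrite E hdiagE /cdiag; congr (_ *m diag_mx _ *m _).
by apply/rowP => k; rewrite mxE -zE.
Qed.

Lemma pos_form_congr A T : T \in unitmx -> pos_form A -> pos_form (T^t* *m A *m T).
Proof.
move=> uT pA v v0; have := pA (T *m v); rewrite trmxC_mul !mulmxA; apply.
apply: contra v0 => /eqP /(congr1 (mulmx (invmx T))).
by rewrite mulKmx // mulmx0 => ->.
Qed.

Definition spectral_fun (f : R -> R) A : op :=
  invmx (spectralmx A) *m
    diag_mx (map_mx (fun z : C => cplx (f (re z))) (spectral_diag A)) *m
    spectralmx A.

(** The value of [f(A)] does not depend on the diagonalization of [A]: the unitary
    that changes one eigenbasis into another intertwines the two diagonals. *)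
Lemma spectral_fun_hdiag (f : R -> R) U s : U \is unitarymx ->
  spectral_fun f (hdiag U s) = hdiag U (f \o s).
Proof.
move=> uU; set A := hdiag U s; have EA : A = hdiag U s by [].
rewrite /spectral_fun; have hA : A^t* = A by rewrite EA trmxC_hdiag.
have [W uW [z E [-> ->]]] := hermitian_spectral hA.
rewrite invmx_unitary //.
have hz k : z 0 k \is Num.real.
  rewrite -(diag_mx_quad z k uW) -E EA quad_hdiag; exact: cplx_real.
have Ez : diag_mx z = cdiag (fun k => re (z 0 k)).
  by rewrite /cdiag; congr diag_mx; apply/rowP => k; rewrite mxE reK.
have -> : map_mx (fun x => cplx (f (re x))) z =
    \row_k cplx ((f \o (fun k => re (z 0 k))) k).
  by apply/rowP => k; rewrite !mxE.
rewrite -/(cdiag _).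
have := @cdiag_intertwine f (W *m U^t*) (fun k => re (z 0 k)) s.
have H1 : cdiag (fun k => re (z 0 k)) *m (W *m U^t*) = W *m U^t* *m cdiag s.
  have : W *m A *m U^t* = cdiag (fun k => re (z 0 k)) *m (W *m U^t*).
    by rewrite E Ez !mulmxA (unitarymxP uW) mul1mx.
  by move=> <-; rewrite EA !hdiagE !mulmxA (mulmxtVK _ uU).
move=> /(_ H1) H2.
rewrite !hdiagE; set D := cdiag (f \o s) in H2 *.
have -> : U^t* *m D *m U = W^t* *m (W *m U^t* *m D) *m U.
  by rewrite !mulmxA unitarymx_mulVmx // mul1mx.
by rewrite -H2 !mulmxA -[RHS]mulmxA unitarymx_mulVmx // mulmx1.
Qed.

(** * Traces of powers *)

(** Young's inequality for [x * z `^ (p - 1)]. *)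
Lemma powR_tangent (p x z : R) : 1 < p -> 0 <= x -> 0 < z ->
  z `^ p + p * z `^ (p - 1) * (x - z) <= x `^ p.
Proof.
move=> p1 x0 z0; have p0 : 0 < p by lra.
have := @conjugate_powR R x (z `^ (p - 1)) p (p / (p - 1)) x0 (powR_ge0 _ _) p0.
rewrite divr_gt0 ?subr_gt0 // => /(_ erefl).
have -> : p^-1 + (p / (p - 1))^-1 = 1 by field; rewrite !gt_eqF //; lra.
move=> /(_ erefl); rewrite -powRrM.
have -> : (p - 1) * (p / (p - 1)) = p by field; rewrite gt_eqF //; lra.
rewrite -(ler_pM2l p0) => H.
have zp : z `^ p = z * z `^ (p - 1) by rewrite mulr_powRB1 // ltW.
have E : p * (x `^ p / p + z `^ p / (p / (p - 1))) = x `^ p + (p - 1) * z `^ p.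
  by field; rewrite !gt_eqF //; lra.
rewrite E in H; rewrite mulrBr -!mulrA [z `^ (p - 1) * z]mulrC -zp.
by rewrite [z `^ (p - 1) * x]mulrC; lra.
Qed.

Lemma powR_jensen (p : R) (w z : 'I_n -> R) : 1 < p ->
  (forall j, 0 <= w j) -> \sum_j w j = 1 -> (forall j, 0 < z j) ->
  (\sum_j w j * z j) `^ p <= \sum_j w j * z j `^ p.
Proof.
move=> p1 w0 w1 z0; set c := \sum_j _.
have c0 : 0 <= c by apply: sumr_ge0 => j _; rewrite mulr_ge0 // ltW.
have [c_eq0|c_neq0] := eqVneq c 0.
  rewrite c_eq0 powR0 ?sumr_ge0 // => [j _|]; first by rewrite mulr_ge0 ?powR_ge0.
  by rewrite gt_eqF //; lra.
have {c_neq0}c0 : 0 < c by rewrite lt0r c_neq0.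
apply: (@le_trans _ _
  (\sum_j w j * (c `^ p + p * c `^ (p - 1) * (z j - c)))); last first.
  by apply: ler_sum => j _; apply: ler_wpM2l => //; apply: powR_tangent => //; rewrite ltW.
rewrite (eq_bigr (fun j => w j * (c `^ p - p * c `^ (p - 1) * c) +
   (w j * z j) * (p * c `^ (p - 1)))); last by move=> j _; ring.
by rewrite big_split /= -!mulr_suml w1 -/c; lra.
Qed.

(** Klein's inequality [Tr A^p >= Tr B^p + p Tr (B^(p-1) (A - B))]: it is the average
    of the scalar tangent inequalities over the doubly stochastic matrix of squared
    moduli that couples the two eigenbases. *)
Lemma klein_powR (p : R) U W (u z : 'I_n -> R) (c : R) : 1 < p ->
  U \is unitarymx -> W \is unitarymx ->
  (forall k, 0 < u k) -> (forall k, 0 < z k) ->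
  \tr (hdiag W (fun k => z k `^ (p - 1)) *m hdiag U u) = cplx c ->
  \sum_k z k `^ p + p * (c - \sum_k z k `^ p) <= \sum_k u k `^ p.
Proof.
move=> p1 uU uW u0 z0.
pose Q := W *m U^t*; pose w j i := sqnorm (Q j i).
have uQ : Q \is unitarymx by rewrite mul_unitarymx ?trmxC_unitary.
have -> : hdiag W (fun k => z k `^ (p - 1)) *m hdiag U u =
    hdiag W (fun k => z k `^ (p - 1)) *m 1%:M *m hdiag U u *m 1%:M^t*.
  by rewrite trmxC1 !mulmx1.
rewrite tr_hdiag_form // mulmx1 => /fmorph_inj <-; rewrite -/Q.
have row1 j : \sum_i w j i = 1 by exact: sqnorm_unitary_row.
have col1 i : \sum_j w j i = 1 by exact: sqnorm_unitary_col.
have -> : \sum_k u k `^ p = \sum_j \sum_i w j i * u i `^ p.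
  rewrite exchange_big /=; apply: eq_bigr => i _.
  by rewrite -mulr_suml col1 mul1r.
have E : \sum_k z k `^ p = \sum_j \sum_i w j i * z j `^ p.
  by apply: eq_bigr => j _; rewrite -mulr_suml row1 mul1r.
rewrite E -sumrB mulr_sumr -big_split /=; apply: ler_sum => j _.
rewrite -sumrB mulr_sumr -big_split /=; apply: ler_sum => i _.
have := powR_tangent p1 (ltW (u0 i)) (z0 j).
move=> /(ler_wpM2l (sqnorm_ge0 (Q j i))); rewrite -/(w j i).
rewrite -(mulr_powRB1 (ltW (z0 j))); last by lra.
by apply: le_trans; rewrite le_eqVlt; apply/orP; left; apply/eqP; ring.
Qed.

Definition powtr (p : R) A : R := re (\tr (spectral_fun (fun x => x `^ p) A)).

Lemma powtr_hdiag (p : R) U y : U \is unitarymx ->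
  powtr p (hdiag U y) = \sum_k y k `^ p.
Proof. by move=> uU; rewrite /powtr spectral_fun_hdiag // tr_hdiag // cplxK. Qed.

Definition diag_coef U A k : R := re ((U *m A *m U^t*) k k).

Lemma diag_coef_hdiag U W z k :
  (U *m hdiag W z *m U^t*) k k =
  cplx (\sum_j sqnorm ((W *m U^t*) j k) * z j).
Proof.
have -> : U *m hdiag W z *m U^t* = (W *m U^t*)^t* *m (cdiag z *m (W *m U^t*)).
  by rewrite !hdiagE trmxC_mul trmxCK !mulmxA.
rewrite mxE rmorph_sum; apply: eq_bigr => j _.
rewrite /cdiag mul_diag_mx !mxE rmorphM /= sqnormE mulrCA.
by rewrite [_^* * _]mulrC [RHS]mulrC.
Qed.

Lemma diag_coef_gt0 U A k : U \is unitarymx -> pos_form A ->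
  0 < diag_coef U A k /\ (U *m A *m U^t*) k k = cplx (diag_coef U A k).
Proof.
move=> uU /pos_form_spectral [W uW [z z0 ->]].
rewrite /diag_coef diag_coef_hdiag cplxK; split => //.
pose Q := W *m U^t*.
have uQ : Q \is unitarymx by rewrite mul_unitarymx ?trmxC_unitary.
have := sqnorm_unitary_col k uQ => Q1.
rewrite lt0r sumr_ge0 ?andbT => [|j _]; last by rewrite mulr_ge0 ?sqnorm_ge0 ?ltW.
apply/negP => /eqP/psumr_eq0P H.
have : \sum_j sqnorm (Q j k) = 0.
  apply: big1 => j _; have := H (fun j _ => mulr_ge0 (sqnorm_ge0 _) (ltW (z0 j))) j.
  move=> /(_ isT)/eqP; rewrite mulf_eq0 [z j == 0]gt_eqF // orbF => /eqP.
  by [].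
by rewrite Q1 => /eqP; rewrite oner_eq0.
Qed.

Lemma hdiag_unit U s : U \is unitarymx -> (forall k, 0 < s k) ->
  hdiag U s \in unitmx.
Proof.
move=> uU s0; have : hdiag U s *m hdiag U (fun k => (s k)^-1) = 1%:M.
  rewrite hdiagM // -(hdiag1 uU); apply: eq_hdiag => k.
  by rewrite divff // gt_eqF.
by move=> /mulmx1_unit [].
Qed.

(** * Monotonicity in the weight *)

(** The map [Gamma] of order [2 a] for the weight [hdiag U tau]. *)
Definition sandwich U (a : R) (tau : 'I_n -> R) X : op :=
  hdiag U (fun k => tau k `^ a) *m X *m hdiag U (fun k => tau k `^ a).

Lemma pos_form_sandwich U a tau X : U \is unitarymx -> (forall k, 0 < tau k) ->
  pos_form X -> pos_form (sandwich U a tau X).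
Proof.
move=> uU t0 pX; rewrite /sandwich -{1}trmxC_hdiag; apply: pos_form_congr => //.
by apply: hdiag_unit => // k; exact: powR_gt0.
Qed.

Lemma sandwichM U a tau tau' X : U \is unitarymx ->
  (forall k, 0 <= tau k) -> (forall k, 0 <= tau' k) ->
  sandwich U a (fun k => tau' k * tau k) X = sandwich U a tau' (sandwich U a tau X).
Proof.
move=> uU t0 t'0; rewrite /sandwich.
set H := hdiag U (fun k => tau k `^ a); set H' := hdiag U (fun k => tau' k `^ a).
have E1 : hdiag U (fun k => (tau' k * tau k) `^ a) = H' *m H.
  by rewrite hdiagM //; apply: eq_hdiag => k; rewrite powRM.
have E2 : H' *m H = H *m H'.
  by rewrite !hdiagM //; apply: eq_hdiag => k; rewrite mulrC.
by rewrite E1 {2}E2 !mulmxA.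
Qed.

Lemma diag_coef_sandwich U (a : R) tau X k : U \is unitarymx ->
  (U *m sandwich U a tau X *m U^t*) k k =
  cplx (tau k `^ a * tau k `^ a) * (U *m X *m U^t*) k k.
Proof.
move=> uU; pose D := cdiag (fun k => tau k `^ a).
have -> : U *m sandwich U a tau X *m U^t* = D *m (U *m X *m U^t*) *m D.
  rewrite /sandwich !hdiagE !mulmxA (unitarymxP uU) mul1mx -/D.
  by rewrite (mulmxtVK _ uU).
rewrite /D /cdiag mul_diag_mx mul_mx_diag !mxE rmorphM /=.
by rewrite mulrAC.
Qed.

Lemma powR_sub1_ge (a r : R) : 0 <= a -> 0 < r -> a * (1 - r^-1) <= r `^ a - 1.
Proof.
move=> a0 r0; have -> : r `^ a = expR (a * ln r) by rewrite /powR gt_eqF.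
have h1 := expR_ge1Dx (a * ln r).
have h2 : 1 - r^-1 <= ln r.
  have := @expR_ge1Dx R (- ln r); rewrite expRN lnK ?posrE //; lra.
by have := ler_wpM2l a0 h2; lra.
Qed.

(** The right-hand side is the diagonal coefficient of index [k] of the [p]-th power
    of the sandwich; the exponent [(2 * p)^-1] makes the coefficient of the sandwich
    itself equal to [tau k `^ p^-1 * diag_coef U X k]. *)
Lemma sandwich_jensen (p : R) U W z tau X k :
  1 < p -> U \is unitarymx -> W \is unitarymx -> (forall j, 0 < z j) ->
  (forall k, 0 < tau k) -> pos_form X ->
  sandwich U (2 * p)^-1 tau X = hdiag W z ->
  tau k * diag_coef U X k `^ p <=
  \sum_j sqnorm ((W *m U^t*) j k) * z j `^ p.
Proof.
move=> p1 uU uW z0 t0 pX EB; have p0 : 0 < p by lra.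
have uQ : W *m U^t* \is unitarymx by rewrite mul_unitarymx ?trmxC_unitary.
have x0 := (diag_coef_gt0 k uU pX).1.
apply: le_trans (powR_jensen p1 _ _ z0).
- have -> : \sum_j sqnorm ((W *m U^t*) j k) * z j = tau k `^ p^-1 * diag_coef U X k.
    apply: (fmorph_inj cplx); rewrite -diag_coef_hdiag -EB diag_coef_sandwich //.
    have [_ ->] := diag_coef_gt0 k uU pX; rewrite -rmorphM /=.
    congr (cplx (_ * _)).
    rewrite -powRD; last by rewrite [tau k == 0]gt_eqF ?implybT.
    by congr (_ `^ _); field; rewrite gt_eqF.
  rewrite powRM ?powR_ge0 ?(ltW x0) // -powRrM mulVf ?gt_eqF //.
  by rewrite powRr1 // ltW.
- by move=> j; exact: sqnorm_ge0.
- exact: sqnorm_unitary_col.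
Qed.

(** Klein's inequality at [B = sandwich U (2 * p)^-1 tau X] bounds the increase of
    the trace from below by [2 p Tr (B^p K)], where [1 + K = (tau' / tau)^(1/2p)];
    the diagonal coefficients of [B^p] are bounded below by Jensen's inequality.
    The price of a step of finite size is the factor [kappa^-1]. *)
Lemma powtr_sandwich_step (p kappa : R) U tau tau' X :
  1 < p -> 0 < kappa -> U \is unitarymx -> pos_form X ->
  (forall k, 0 < tau k) -> (forall k, tau k <= tau' k) ->
  (forall k, tau' k <= kappa * tau k) ->
  kappa^-1 * \sum_k (tau' k - tau k) * diag_coef U X k `^ p <=
  powtr p (sandwich U (2 * p)^-1 tau' X) - powtr p (sandwich U (2 * p)^-1 tau X).
Proof.
move=> p1 kap0 uU pX t0 tt' t'k; set a := (2 * p)^-1.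
have p0 : 0 < p by lra.
have a0 : 0 < a by rewrite invr_gt0 mulr_gt0.
have t'0 k : 0 < tau' k by exact: lt_le_trans (tt' k).
pose r k := tau' k / tau k.
have r0 k : 0 < r k by rewrite divr_gt0.
have r1 k : 1 <= r k by rewrite ler_pdivlMr // mul1r.
set B := sandwich U a tau X.
have pB : pos_form B by exact: pos_form_sandwich.
have EB' : sandwich U a tau' X = sandwich U a r B.
  rewrite -sandwichM // => [|k|k]; try exact: ltW.
  congr (sandwich _ _ _ _); apply/funext => k.
  by rewrite /r divfK // gt_eqF.
have [U' uU' [u u0 Eu]] := pos_form_spectral (pos_form_sandwich a uU r0 pB).
have [W uW [z z0 EB]] := pos_form_spectral pB.
rewrite EB' Eu EB !powtr_hdiag //.
pose eps k := r k `^ a - 1.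
have eps0 k : 0 <= eps k.
  rewrite subr_ge0; have -> : 1 = 1 `^ a :> R by rewrite powR1.
  by apply: ge0_ler_powR; rewrite ?nnegrE //; exact: ltW.
pose K := hdiag U eps.
have EK : hdiag U (fun k => r k `^ a) = 1%:M + K.
  by rewrite -(hdiag1 uU) hdiagD; apply: eq_hdiag => k; rewrite /eps; ring.
have Eu' : hdiag U' u = B + K *m B + B *m K + K *m B *m K.
  by rewrite -Eu /sandwich EK mulmxDl mul1mx mulmxDr mulmx1 mulmxDl addrA.
pose w j k := sqnorm ((W *m U^t*) j k).
have uQ : W *m U^t* \is unitarymx by rewrite mul_unitarymx ?trmxC_unitary.
pose c1 := \sum_k eps k * \sum_j w j k * z j `^ p.
pose c2 := \sum_k \sum_j z k `^ (p - 1) * z j * sqnorm ((W *m K *m W^t*) k j).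
have c2_ge0 : 0 <= c2.
  apply: sumr_ge0 => k _; apply: sumr_ge0 => j _.
  by rewrite mulr_ge0 ?sqnorm_ge0 // mulr_ge0 ?powR_ge0 // ltW.
(* [c1 = Tr (B^p K)] and [c2 = Tr (B^(p-1) K B K)] *)
pose D := hdiag W (fun k => z k `^ (p - 1)).
have DB : D *m B = hdiag W (fun k => z k `^ p).
  rewrite EB hdiagM //; apply: eq_hdiag => k.
  by rewrite mulrC mulr_powRB1 // ltW.
have BD : B *m D = hdiag W (fun k => z k `^ p).
  rewrite EB hdiagM //; apply: eq_hdiag => k.
  by rewrite mulr_powRB1 // ltW.
have trK : \tr (hdiag W (fun k => z k `^ p) *m K) = cplx c1.
  have -> : hdiag W (fun k => z k `^ p) *m K =
     hdiag W (fun k => z k `^ p) *m 1%:M *m hdiag U eps *m 1%:M^t*.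
    by rewrite trmxC1 !mulmx1.
  rewrite tr_hdiag_form // mulmx1; congr (cplx _).
  rewrite exchange_big; apply: eq_bigr => k _; rewrite mulr_sumr.
  by apply: eq_bigr => j _; rewrite /w; ring.
have trD : \tr (D *m hdiag U' u) = cplx (\sum_k z k `^ p + c1 + c1 + c2).
  rewrite Eu' !mulmxDr !linearD !rmorphD /=.
  have -> : \tr (D *m (K *m B)) = cplx c1.
    by rewrite mulmxA mxtrace_mulC mulmxA BD trK.
  have -> : \tr (D *m (B *m K)) = cplx c1 by rewrite mulmxA DB trK.
  rewrite DB tr_hdiag //; congr (_ + _ + _ + _).
  rewrite /c2 -tr_hdiag_form // trmxC_hdiag EB.
  by rewrite !mulmxA.
have klein := klein_powR p1 uU' uW u0 z0 trD.
have jens k : tau k * diag_coef U X k `^ p <= \sum_j w j k * z j `^ p.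
  exact: sandwich_jensen.
have : p * (c1 + c1) <= \sum_k u k `^ p - \sum_k z k `^ p.
  have := mulr_ge0 (ltW p0) c2_ge0; move: klein.
  set Z := \sum_k z k `^ p; set Y := \sum_k u k `^ p; lra.
apply: le_trans; rewrite mulrDr -mulrDl /c1 !mulr_sumr.
apply: ler_sum => k _.
have x0 := (diag_coef_gt0 k uU pX).1.
have xp : 0 <= diag_coef U X k `^ p by exact: powR_ge0.
apply: (@le_trans _ _ ((p + p) * (eps k * (tau k * diag_coef U X k `^ p)))).
  rewrite !mulrA; apply: ler_wpM2r => //.
  apply: (@le_trans _ _ ((p + p) * (a * (1 - (r k)^-1)) * tau k)).
    rewrite /a (_ : (p + p) * _ * tau k = (tau' k)^-1 * (tau' k - tau k) * tau k).
      rewrite mulrAC; apply: ler_wpM2r; first by rewrite subr_ge0.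
      rewrite mulrC ler_pdivlMr // mulrC ler_pdivrMr // mulrC.
      exact: t'k.
    by rewrite /r; field; rewrite !gt_eqF.
  apply: ler_wpM2r; first exact: ltW.
  apply: ler_wpM2l; first by lra.
  by apply: powR_sub1_ge => //; exact: ltW.
apply: ler_wpM2l; first by lra.
by apply: ler_wpM2l.
Qed.

(** Along a geometric path every step has the same factor [kappa^-1], so the
    increments telescope. *)
Lemma powtr_sandwich_geometric (p kappa : R) U tau (r : 'I_n -> R) X (m : nat) :
  1 < p -> U \is unitarymx -> pos_form X ->
  (forall k, 0 < tau k) -> (forall k, 1 <= r k) -> (forall k, r k <= kappa) ->
  0 < kappa ->
  kappa^-1 * \sum_k (tau k * r k ^+ m - tau k) * diag_coef U X k `^ p <=
  powtr p (sandwich U (2 * p)^-1 (fun k => tau k * r k ^+ m) X) -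
  powtr p (sandwich U (2 * p)^-1 tau X).
Proof.
move=> p1 uU pX t0 r1 rk kap0; elim: m => [|m IH].
  rewrite (_ : (fun k => tau k * r k ^+ 0) = tau).
    by rewrite subrr big1 ?mulr0 // => k _; rewrite expr0 mulr1 subrr mul0r.
  by apply/funext => k; rewrite expr0 mulr1.
have r0 k : 0 < r k by exact: lt_le_trans (r1 k).
pose t i k := tau k * r k ^+ i.
have ti0 i k : 0 < t i k by rewrite mulr_gt0 // exprn_gt0.
have := @powtr_sandwich_step p kappa U (t m) (t m.+1) X p1 kap0 uU pX (ti0 m).
have h1 k : t m k <= t m.+1 k.
  by rewrite /t exprS mulrCA ler_peMl // ltW // ti0.
have h2 k : t m.+1 k <= kappa * t m k.
  by rewrite /t exprS mulrCA ler_wpM2r // ltW // ti0.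
move=> /(_ h1 h2) H.
have := lerD H IH; rewrite addrA subrK; apply: le_trans.
rewrite -mulrDr -big_split /=; apply: ler_wpM2l; first by rewrite invr_ge0 ltW.
by apply: ler_sum => k _; rewrite -mulrDl addrA subrK.
Qed.

(** The path from [tau] to [tau'] is cut into [m.+1] geometric steps; their common
    factor tends to [1] as [m] grows. *)
Lemma powtr_sandwich_mono (p : R) U tau tau' X :
  1 < p -> U \is unitarymx -> pos_form X ->
  (forall k, 0 < tau k) -> (forall k, tau k <= tau' k) ->
  \sum_k (tau' k - tau k) * diag_coef U X k `^ p <=
  powtr p (sandwich U (2 * p)^-1 tau' X) - powtr p (sandwich U (2 * p)^-1 tau X).
Proof.
move=> p1 uU pX t0 tt'; set S := \sum_k _; set D := powtr _ _ - _.
have S0 : 0 <= S.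
  by apply: sumr_ge0 => k _; rewrite mulr_ge0 ?powR_ge0 // subr_ge0.
have t'0 k : 0 < tau' k by exact: lt_le_trans (tt' k).
pose q k := tau' k / tau k.
have q1 k : 1 <= q k by rewrite ler_pdivlMr // mul1r.
have q0 k : 0 < q k by exact: lt_le_trans (q1 k).
(* a common upper bound of the ratios [q k] *)
pose q_ := 1 + \sum_k q k.
have qq k : q k <= q_.
  rewrite /q_ (bigD1 k) //= addrCA lerDl addr_ge0 //.
  by apply: sumr_ge0 => j _; exact: ltW.
have q_0 : 0 < q_.
  by rewrite ltr_pwDl // sumr_ge0 // => j _; exact: ltW.
have main (m : nat) : (1 - ln q_ / m.+1%:R) * S <= D.
  have m0 : 0 < (m.+1%:R)^-1 :> R by rewrite invr_gt0 ltr0Sn.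
  have mE (x : R) : 0 < x -> (x `^ (m.+1%:R)^-1) ^+ m.+1 = x.
    move=> x0; rewrite -powR_mulrn ?powR_ge0 // -powRrM mulVf ?pnatr_eq0 //.
    by rewrite powRr1 // ltW.
  have := @powtr_sandwich_geometric p (q_ `^ (m.+1%:R)^-1) U tau
    (fun k => q k `^ (m.+1%:R)^-1) X m.+1 p1 uU pX t0.
  rewrite (_ : (fun k => tau k * _) = tau'); last first.
    by apply/funext => k; rewrite mE // /q mulrC divfK // gt_eqF.
  have mono (x y : R) : 0 <= x -> x <= y ->
      x `^ (m.+1%:R)^-1 <= y `^ (m.+1%:R)^-1.
    move=> x0 xy; apply: (ge0_ler_powR (ltW m0)) => //.
    by rewrite nnegrE (le_trans x0).
  have h1 k : 1 <= q k `^ (m.+1%:R)^-1.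
    by have := mono 1 (q k) ler01 (q1 k); rewrite powR1.
  have h2 k : q k `^ (m.+1%:R)^-1 <= q_ `^ (m.+1%:R)^-1.
    exact: mono (ltW (q0 k)) (qq k).
  rewrite -/D => /(_ h1 h2 (powR_gt0 _ q_0)); apply: le_trans.
  rewrite (_ : \sum_k _ = S); last first.
    by apply: eq_bigr => k _; rewrite mE // /q [tau k * _]mulrC divfK // gt_eqF.
  apply: ler_wpM2r => //.
  rewrite /powR gt_eqF // -expRN [_ * ln _]mulrC.
  by have := @expR_ge1Dx R (- (ln q_ / m.+1%:R)).
(* [m] exceeds [ln q_ * S / (S - D)], so that [main m] contradicts [D < S] *)
rewrite leNgt; apply/negP => DS.
have SD : 0 < S - D by rewrite subr_gt0.
have := archi_boundP (normr_ge0 (ln q_ * S / (S - D))).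
set m := Num.bound _ => Hm.
have := main m; apply/negP; rewrite -ltNge.
have {Hm}Hm : ln q_ * S / (S - D) < m.+1%:R.
  apply: le_lt_trans (ler_norm _) _; apply: lt_trans Hm _.
  by rewrite ltr_nat.
rewrite ltr_pdivrMr // in Hm.
have {}Hm : ln q_ * S / m.+1%:R < S - D.
  by rewrite ltr_pdivrMr ?ltr0Sn // [_ * m.+1%:R]mulrC.
by rewrite mulrBl mul1r mulrAC ltrBrDl -ltrBrDr.
Qed.

Lemma powtr_sandwich_scale (p lam : R) U tau X :
  1 < p -> 0 < lam -> U \is unitarymx -> pos_form X -> (forall k, 0 < tau k) ->
  powtr p (sandwich U (2 * p)^-1 (fun k => lam * tau k) X) =
  lam * powtr p (sandwich U (2 * p)^-1 tau X).
Proof.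
move=> p1 l0 uU pX t0; have p0 : 0 < p by lra.
have [W uW [z z0 E]] := pos_form_spectral (pos_form_sandwich (2 * p)^-1 uU t0 pX).
have -> : sandwich U (2 * p)^-1 (fun k => lam * tau k) X =
    cplx (lam `^ p^-1) *: sandwich U (2 * p)^-1 tau X.
  rewrite /sandwich.
  have -> : hdiag U (fun k => (lam * tau k) `^ (2 * p)^-1) =
      cplx (lam `^ (2 * p)^-1) *: hdiag U (fun k => tau k `^ (2 * p)^-1).
    by rewrite hdiagZ; apply: eq_hdiag => k; rewrite powRM // ltW.
  rewrite -scalemxAr -!scalemxAl scalerA -rmorphM; congr (cplx _ *: _).
  rewrite -powRD; last by rewrite [lam == 0]gt_eqF ?implybT.
  by congr (_ `^ _); field; rewrite gt_eqF.
rewrite E hdiagZ !powtr_hdiag // mulr_sumr; apply: eq_bigr => k _.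
rewrite powRM ?powR_ge0 ?(ltW (z0 k)) // -powRrM mulVf ?gt_eqF //.
by rewrite powRr1 // ltW.
Qed.

Lemma powtr_sandwich_ge (p : R) U tau X :
  1 < p -> U \is unitarymx -> pos_form X -> (forall k, 0 < tau k) ->
  \sum_k tau k * diag_coef U X k `^ p <= powtr p (sandwich U (2 * p)^-1 tau X).
Proof.
move=> p1 uU pX t0.
have [W uW [z z0 E]] := pos_form_spectral (pos_form_sandwich (2 * p)^-1 uU t0 pX).
have uQ : W *m U^t* \is unitarymx by rewrite mul_unitarymx ?trmxC_unitary.
rewrite E powtr_hdiag //.
have -> : \sum_k z k `^ p = \sum_k \sum_j sqnorm ((W *m U^t*) j k) * z j `^ p.
  rewrite exchange_big /=; apply: eq_bigr => j _.
  by rewrite -mulr_suml sqnorm_unitary_row // mul1r.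
by apply: ler_sum => k _; exact: sandwich_jensen.
Qed.

(** The difference [||X||_p^p - ||X||_1^p] for the state [hdiag U tau]; see
    [wnorm_var]. *)
Definition beckner_var (p : R) U tau X : R :=
  powtr p (sandwich U (2 * p)^-1 tau X) -
  (\sum_k tau k * diag_coef U X k) `^ p.

Lemma beckner_var_ge0 (p : R) U tau X :
  1 < p -> U \is unitarymx -> pos_form X -> (forall k, 0 < tau k) ->
  \sum_k tau k = 1 -> 0 <= beckner_var p U tau X.
Proof.
move=> p1 uU pX t0 t1; rewrite subr_ge0.
apply: le_trans (powtr_sandwich_ge p1 uU pX t0).
apply: powR_jensen => // k; first exact: ltW.
exact: (diag_coef_gt0 k uU pX).1.
Qed.

(** Monotonicity from [tau] to [lam * tau'], with the power of each diagonal
    coefficient [x_k] then bounded by its tangent at the mean [c'] of the [x_k] with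
    respect to [tau']. *)
Lemma beckner_var_le (p lam : R) U tau tau' X :
  1 < p -> 0 < lam -> U \is unitarymx -> pos_form X ->
  (forall k, 0 < tau k) -> (forall k, 0 < tau' k) ->
  \sum_k tau k = 1 -> \sum_k tau' k = 1 -> (forall k, tau k <= lam * tau' k) ->
  beckner_var p U tau X <= lam * beckner_var p U tau' X.
Proof.
move=> p1 l0 uU pX t0 t'0 t1 t'1 tt'; rewrite /beckner_var.
have x0 k : 0 < diag_coef U X k by exact: (diag_coef_gt0 k uU pX).1.
have := @powtr_sandwich_mono p U tau (fun k => lam * tau' k) X p1 uU pX t0 tt'.
rewrite powtr_sandwich_scale //.
set T := powtr _ _; set T' := powtr _ _.
set c := \sum_k tau k * _; set c' := \sum_k tau' k * _.
have c0 : 0 <= c by apply: sumr_ge0 => k _; rewrite mulr_ge0 ?ltW.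
have c'0 : 0 < c'.
  have c'0 : 0 <= c' by apply: sumr_ge0 => k _; rewrite mulr_ge0 ?ltW.
  rewrite lt0r c'0 andbT; apply/eqP => /psumr_eq0P H.
  have : \sum_k tau' k = 0.
    apply: big1 => k _; have := H (fun k _ => ltW (mulr_gt0 (t'0 k) (x0 k))) k isT.
    by move=> /eqP; rewrite mulf_eq0 [diag_coef U X k == 0]gt_eqF // orbF => /eqP.
  by rewrite t'1 => /eqP; rewrite oner_eq0.
pose s := p * c' `^ (p - 1).
have : \sum_k (lam * tau' k - tau k) * (c' `^ p + s * (diag_coef U X k - c')) <=
    \sum_k (lam * tau' k - tau k) * diag_coef U X k `^ p.
  apply: ler_sum => k _; apply: ler_wpM2l; first by rewrite subr_ge0.
  by apply: powR_tangent => //; exact: ltW.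
rewrite (eq_bigr (fun k => (lam * (c' `^ p - s * c')) * tau' k -
    (c' `^ p - s * c') * tau k + (lam * s) * (tau' k * diag_coef U X k) -
    s * (tau k * diag_coef U X k))); last by move=> k _; ring.
rewrite !big_split /= !sumrN -!mulr_sumr t1 t'1 -/c -/c'.
have := powR_tangent p1 c0 c'0; rewrite -/s; lra.
Qed.

(** * Comparison of difference forms *)

(** With [M = hdiag U0 mu], [Y = hdiag U y] and [M Y M = hdiag U' y'], the second
    term is [(c' Y + t M^-2)^-1], and [c' Y + t M^-2 >= c Y + lam t]. *)
Lemma congr_inverse_le U0 (mu : 'I_n -> R) U y U' y' (c c' lam t : R) :
  U0 \is unitarymx -> U \is unitarymx -> U' \is unitarymx ->
  (forall k, 0 < mu k) -> (forall k, 0 < y k) -> (forall k, 0 < y' k) ->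
  hdiag U0 mu *m hdiag U y *m hdiag U0 mu = hdiag U' y' ->
  0 < c -> c <= c' -> 0 < lam -> (forall k, mu k ^+ 2 * lam <= 1) -> 0 <= t ->
  nonneg_form (hdiag U (fun k => (c * y k + lam * t)^-1) -
    hdiag U0 mu *m hdiag U' (fun k => (c' * y' k + t)^-1) *m hdiag U0 mu).
Proof.
move=> uU0 uU uU' m0 y0 y'0 EY c0 cc' l0 ml t0.
have c'0 : 0 < c' by exact: lt_le_trans cc'.
pose B := hdiag U (fun k => c * y k + lam * t).
pose N := hdiag U0 (fun k => (mu k)^-1).
pose Q := hdiag U' (fun k => c' * y' k + t).
pose M := hdiag U0 mu; rewrite -/M in EY *.
set Q' := hdiag U' _.
have hM : M^t* = M by exact: trmxC_hdiag.
have hN : N^t* = N by exact: trmxC_hdiag.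
have MN : M *m N = 1%:M.
  rewrite /M /N (hdiagM _ _ uU0) -(hdiag1 uU0); apply: eq_hdiag => k.
  by rewrite divff // gt_eqF.
have NM : N *m M = 1%:M by exact: mulmx1C.
have QQ' : Q *m Q' = 1%:M.
  rewrite /Q /Q' (hdiagM _ _ uU') -(hdiag1 uU'); apply: eq_hdiag => k.
  by rewrite divff // gt_eqF // ltr_wpDr // mulr_gt0.
have EQ : N *m Q *m N = hdiag U (fun k => c' * y k) +
    hdiag U0 (fun k => t * (mu k)^-1 ^+ 2).
  have -> : Q = cplx c' *: (M *m hdiag U y *m M) + cplx t *: 1%:M.
    rewrite EY -(hdiag1 uU') !hdiagZ hdiagD; apply: eq_hdiag => k.
    by rewrite mulr1.
  rewrite mulmxDr mulmxDl; congr (_ + _).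
    rewrite -hdiagZ -scalemxAr -scalemxAl; congr (_ *: _).
    by rewrite !mulmxA NM mul1mx -mulmxA MN mulmx1.
  rewrite -scalemxAr mulmx1 -scalemxAl /N (hdiagM _ _ uU0) hdiagZ.
  by apply: eq_hdiag => k; rewrite expr2.
have hQ : Q^t* = Q by exact: trmxC_hdiag.
have hQ' : Q'^t* = Q' by exact: trmxC_hdiag.
apply: (@nonneg_form_inv (N *m Q *m N) B).
- have -> : N *m Q *m N *m (M *m Q' *m M) = N *m (Q *m (N *m M) *m Q') *m M.
    by rewrite !mulmxA.
  by rewrite NM mulmx1 QQ' mulmx1.
- rewrite /B (hdiagM _ _ uU) -(hdiag1 uU); apply: eq_hdiag => k.
  by rewrite divff // gt_eqF // ltr_wpDr ?mulr_ge0 ?(ltW l0) // mulr_gt0.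
- by rewrite !trmxC_mul hQ hN mulmxA.
- by rewrite !trmxC_mul hQ' hM mulmxA.
- exact: trmxC_hdiag.
- have -> : N *m Q *m N - B = hdiag U (fun k => (c' - c) * y k) +
      hdiag U0 (fun k => t * ((mu k)^-1 ^+ 2 - lam)).
    rewrite EQ; apply/eqP; rewrite subr_eq; apply/eqP.
    have -> : B = hdiag U (fun k => c * y k) + hdiag U0 (fun=> lam * t).
      have -> : hdiag U0 (fun=> lam * t) = hdiag U (fun=> lam * t).
        have E (V : op) : V \is unitarymx ->
            hdiag V (fun=> lam * t) = cplx (lam * t) *: 1%:M.
          by move=> uV; rewrite -(hdiag1 uV) hdiagZ; apply: eq_hdiag => k; rewrite mulr1.
        by rewrite (E U0) // (E U).
      by rewrite hdiagD.
    rewrite addrACA !hdiagD; congr (_ + _); apply: eq_hdiag => k; ring.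
  apply: nonneg_formD; apply: nonneg_form_hdiag => k.
    by rewrite mulr_ge0 ?subr_ge0 // ltW.
  rewrite mulr_ge0 // subr_ge0 exprVn -[X in _ <= X]mul1r.
  by rewrite ler_pdivlMr ?exprn_gt0 // mulrC.
- apply: nonneg_form_hdiag => k.
  by rewrite invr_ge0 addr_ge0 ?mulr_ge0 // ltW.
Qed.

Lemma tr_congr_le (G H G' H' M T : op) : M^t* = M ->
  0 <= \tr ((G - M *m G' *m M) *m T *m H *m T^t*) ->
  0 <= \tr ((H - M *m H' *m M) *m (T^t* *m M) *m G' *m (T^t* *m M)^t*) ->
  \tr (G' *m (M *m T *m M) *m H' *m (M *m T *m M)^t*) <=
  \tr (G *m T *m H *m T^t*).
Proof.
move=> hM; have trB (A B : op) : \tr (A - B) = \tr A - \tr B by exact: linearB.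
rewrite !mulmxBl !trB !subr_ge0 => p1 p2.
apply: le_trans p1.
rewrite !trmxC_mul trmxCK hM in p2 *.
have E1 : \tr (M *m G' *m M *m T *m H *m T^t*) =
    \tr (H *m (T^t* *m M) *m G' *m (M *m T)).
  have -> : M *m G' *m M *m T *m H *m T^t* = (M *m G' *m M *m T) *m (H *m T^t*).
    by rewrite !mulmxA.
  by rewrite mxtrace_mulC !mulmxA.
have E2 : \tr (G' *m (M *m T *m M) *m H' *m (M *m (T^t* *m M))) =
    \tr (M *m H' *m M *m (T^t* *m M) *m G' *m (M *m T)).
  have -> : G' *m (M *m T *m M) *m H' *m (M *m (T^t* *m M)) =
      (G' *m (M *m T)) *m (M *m H' *m M *m (T^t* *m M)).
    by rewrite !mulmxA.
  by rewrite mxtrace_mulC !mulmxA.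
by rewrite E1 E2.
Qed.

Lemma tr_resolvent_le U0 (mu : 'I_n -> R) U y U' y' (a b a' b' lam t : R) T :
  U0 \is unitarymx -> U \is unitarymx -> U' \is unitarymx ->
  (forall k, 0 < mu k) -> (forall k, 0 < y k) -> (forall k, 0 < y' k) ->
  hdiag U0 mu *m hdiag U y *m hdiag U0 mu = hdiag U' y' ->
  0 < a -> a <= a' -> 0 < b -> b <= b' ->
  0 < lam -> (forall k, mu k ^+ 2 * lam <= 1) -> 0 <= t ->
  \tr (hdiag U' (fun k => (b' * y' k + t)^-1) *m
         (hdiag U0 mu *m T *m hdiag U0 mu) *m
       hdiag U' (fun k => (a' * y' k + t)^-1) *m
         (hdiag U0 mu *m T *m hdiag U0 mu)^t*) <=
  \tr (hdiag U (fun k => (b * y k + lam * t)^-1) *m T *m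
       hdiag U (fun k => (a * y k + lam * t)^-1) *m T^t*).
Proof.
move=> uU0 uU uU' m0 y0 y'0 EY a0 aa' b0 bb' l0 ml t0.
have leG := congr_inverse_le uU0 uU uU' m0 y0 y'0 EY b0 bb' l0 ml t0.
have leH := congr_inverse_le uU0 uU uU' m0 y0 y'0 EY a0 aa' l0 ml t0.
set s := fun k => (a * y k + lam * t)^-1 in leH *.
have s0 k : 0 <= s k by rewrite invr_ge0 addr_ge0 ?mulr_ge0 // ltW.
set s' := fun k => (b' * y' k + t)^-1 in leG *.
have s'0 k : 0 <= s' k.
  by rewrite invr_ge0 addr_ge0 ?mulr_ge0 ?(ltW (y'0 _)) // ltW // (lt_le_trans b0).
apply: tr_congr_le; first exact: trmxC_hdiag.
- exact: tr_nonneg_hdiag leG s0.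
- exact: tr_nonneg_hdiag leH s'0.
Qed.

(** The trace of [(V A^q - B^q V)^* (V A - B V)] for [A = a Y], [B = b Y] and
    [Y = hdiag U y]: a quadratic form in [V] which is symmetric in the function
    [x `^ q] and the identity. *)
Definition deriv_form (q a b : R) U (y : 'I_n -> R) (V : op) : R :=
  \sum_k \sum_l sqnorm ((U *m V *m U^t*) k l) *
    (((a * y l) `^ q - (b * y k) `^ q) * (a * y l - b * y k)).

Lemma deriv_entry U y V (a b : R) k l : U \is unitarymx ->
  (U *m (cplx a *: (V *m hdiag U y) - cplx b *: (hdiag U y *m V)) *m U^t*) k l =
  cplx (a * y l - b * y k) * (U *m V *m U^t*) k l.
Proof.
move=> uU; rewrite hdiagE.
have -> : U *m (cplx a *: (V *m (U^t* *m cdiag y *m U)) -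
     cplx b *: (U^t* *m cdiag y *m U *m V)) *m U^t* =
   cplx a *: ((U *m V *m U^t*) *m cdiag y) - cplx b *: (cdiag y *m (U *m V *m U^t*)).
  rewrite mulmxBr mulmxBl -!scalemxAr -!scalemxAl !mulmxA (mulmxtVK _ uU).
  by rewrite (unitarymxP uU) mul1mx.
rewrite /cdiag mul_mx_diag mul_diag_mx !mxE rmorphB !rmorphM /=.
by ring.
Qed.

Lemma tr_deriv_form U y V (a b : R) (g h : 'I_n -> R) : U \is unitarymx ->
  let T := cplx a *: (V *m hdiag U y) - cplx b *: (hdiag U y *m V) in
  \tr (hdiag U g *m T *m hdiag U h *m T^t*) =
  cplx (\sum_k \sum_l sqnorm ((U *m V *m U^t*) k l) *
     (g k * h l * (a * y l - b * y k) ^+ 2)).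
Proof.
move=> uU T; rewrite tr_hdiag_form //; congr (cplx _).
apply: eq_bigr => k _; apply: eq_bigr => l _.
rewrite /T deriv_entry // sqnormZ; ring.
Qed.

(** Replacing [x `^ q] by [x / (x + t)] turns the difference form into [t] times the
    trace of [tr_resolvent_le], where the inequality is known for every [t]; it then
    passes to the power [q].  The bound of [tr_resolvent_le] has resolvents at
    [lam * t]; dividing by [lam] moves the constant into the arguments, which
    become [rho / lam] times those of the right-hand form. *)
Lemma deriv_form_le (q : R) U0 (mu : 'I_n -> R) U y U' y' V (a b a' b' rho lam : R) :
  0 < q -> q <= 1 ->
  U0 \is unitarymx -> U \is unitarymx -> U' \is unitarymx ->
  (forall k, 0 < mu k) -> (forall k, 0 < y k) -> (forall k, 0 < y' k) ->
  let M := hdiag U0 mu in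
  M *m hdiag U y *m M = hdiag U' y' ->
  cplx a' *: (V *m hdiag U' y') - cplx b' *: (hdiag U' y' *m V) =
  M *m (cplx a *: (V *m hdiag U y) - cplx b *: (hdiag U y *m V)) *m M ->
  0 < a -> 0 < b -> 0 < rho -> rho * a <= a' -> rho * b <= b' ->
  0 < lam -> (forall k, mu k ^+ 2 * lam <= 1) ->
  deriv_form q a' b' U' y' V <=
  rho ^- 2 * (rho / lam) `^ (q + 1) * deriv_form q a b U y V.
Proof.
move=> q0 q1 uU0 uU uU' m0 y0 y'0 M EY ET a0 b0 r0 aa' bb' l0 ml.
have a'0 : 0 < a' by apply: lt_le_trans aa'; rewrite mulr_gt0.
have b'0 : 0 < b' by apply: lt_le_trans bb'; rewrite mulr_gt0.
pose I := ('I_n * 'I_n)%type.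
pose om (i : I) := sqnorm ((U *m V *m U^t*) i.1 i.2).
pose om' (i : I) := sqnorm ((U' *m V *m U'^t*) i.1 i.2).
pose c := rho / lam; have c0 : 0 < c by rewrite divr_gt0.
have cE : c = rho / lam by []; clearbody c.
(* left summands carry the form to be bounded, right summands the bounding one *)
pose w (i : I + I) := match i with inl i => - om' i | inr i => rho ^- 2 * om i end.
pose X (i : I + I) :=
  match i with inl i => a' * y' i.2 | inr i => c * (a * y i.2) end.
pose Y (i : I + I) :=
  match i with inl i => b' * y' i.1 | inr i => c * (b * y i.1) end.
have X0 (i : (I + I)%type) : 0 < X i.
  by case: i => -[k l] /=; do ?apply: mulr_gt0 => //.
have Y0 (i : (I + I)%type) : 0 < Y i.
  by case: i => -[k l] /=; do ?apply: mulr_gt0 => //.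
have dfE V1 U1 y1 a1 b1 : deriv_form q a1 b1 U1 y1 V1 =
    \sum_(i : I) sqnorm ((U1 *m V1 *m U1^t*) i.1 i.2) *
      (((a1 * y1 i.2) `^ q - (b1 * y1 i.1) `^ q) * (a1 * y1 i.2 - b1 * y1 i.1)).
  by rewrite /deriv_form pair_bigA.
have E : rho ^- 2 * c `^ (q + 1) * deriv_form q a b U y V - deriv_form q a' b' U' y' V
   = \sum_i w i * ((X i `^ q - Y i `^ q) * (X i - Y i)).
  rewrite !dfE big_sumType /= addrC mulr_sumr -sumrN; congr (_ + _); last first.
    by apply: eq_bigr => i _; rewrite mulNr.
  apply: eq_bigr => i _; rewrite ![(c * _) `^ q]powRM ?mulr_ge0 ?(ltW c0) ?ltW //.
  rewrite powRD; last by rewrite [c == 0]gt_eqF ?implybT.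
  rewrite powRr1 ?(ltW c0) // /om; ring.
rewrite -subr_ge0 -cE E.
apply: power_difference_of_resolvents => // t t0.
rewrite big_sumType /=.
have ra : 0 < rho * a by rewrite mulr_gt0.
have rb : 0 < rho * b by rewrite mulr_gt0.
have := @tr_resolvent_le U0 mu U y U' y' (rho * a) (rho * b) a' b' lam t
  (cplx a *: (V *m hdiag U y) - cplx b *: (hdiag U y *m V))
  uU0 uU uU' m0 y0 y'0 EY ra aa' rb bb' l0 ml t0.
rewrite -/M -ET !tr_deriv_form // -subr_ge0 -rmorphB cplx_ge0 /= => H.
have {H}H := mulr_ge0 t0 H; apply: le_trans H _.
rewrite mulrBr addrC !pair_bigA /= !mulr_sumr -sumrN le_eqVlt; apply/orP; left.
apply/eqP; congr (_ + _); apply: eq_bigr => i _.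
  rewrite /om cE; set N := sqnorm _.
  have D1 : 0 < rho * b * y i.1 + lam * t by rewrite ltr_wpDr ?mulr_ge0 ?(ltW l0) ?mulr_gt0.
  have D2 : 0 < rho * a * y i.2 + lam * t by rewrite ltr_wpDr ?mulr_ge0 ?(ltW l0) ?mulr_gt0.
  rewrite -mulrA [lam * t]mulrC in D1; rewrite -mulrA [lam * t]mulrC in D2.
  by field; rewrite !gt_eqF.
rewrite /om'; set N := sqnorm _.
have D1 : 0 < b' * y' i.1 + t by rewrite ltr_wpDr ?mulr_gt0.
have D2 : 0 < a' * y' i.2 + t by rewrite ltr_wpDr ?mulr_gt0.
by field; rewrite !gt_eqF.
Qed.

Lemma deriv_form_ge0 (q a b : R) U y V : 0 < q -> 0 < a -> 0 < b ->
  (forall k, 0 < y k) -> 0 <= deriv_form q a b U y V.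
Proof.
move=> q0 a0 b0 y0; apply: sumr_ge0 => k _; apply: sumr_ge0 => l _.
rewrite mulr_ge0 ?sqnorm_ge0 //.
have P (x z : R) : 0 < x -> 0 < z -> x <= z -> x `^ q <= z `^ q.
  by move=> x0 z0 xz; apply: (ge0_ler_powR (ltW q0)); rewrite ?nnegrE // ltW.
have ay : 0 < a * y l by rewrite mulr_gt0.
have bY : 0 < b * y k by rewrite mulr_gt0.
have [h|h] := leP (a * y l) (b * y k).
  by rewrite mulr_le0 // subr_le0 // P.
by rewrite mulr_ge0 // subr_ge0 ?P // ltW.
Qed.

(** * The Dirichlet form as a difference form *)

Lemma hdiag_commutation U s V (om x : R) : U \is unitarymx ->
  (forall k, 0 < s k) ->
  hdiag U s *m V *m invmx (hdiag U s) = cplx (expR (- om)) *: V ->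
  hdiag U (fun k => s k `^ x) *m V =
  cplx (expR (- (om * x))) *: (V *m hdiag U (fun k => s k `^ x)).
Proof.
move=> uU s0 E; have uS := hdiag_unit uU s0.
have {}E : hdiag U s *m V = cplx (expR (- om)) *: (V *m hdiag U s).
  by rewrite scalemxAl -E -mulmxA mulVmx // mulmx1.
pose Q := U *m V *m U^t*.
have EQ f : hdiag U f *m V = U^t* *m (cdiag f *m Q) *m U.
  by rewrite hdiagE /Q !mulmxA -[RHS]mulmxA unitarymx_mulVmx // mulmx1.
have QE f : V *m hdiag U f = U^t* *m (Q *m cdiag f) *m U.
  by rewrite hdiagE /Q !mulmxA unitarymx_mulVmx // mul1mx.
have cZ (c : R) f : cplx c *: cdiag f = cdiag (fun k => c * f k).
  by apply/matrixP => i j; rewrite !mxE rmorphM mulrnAr.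
have main : cdiag s *m Q = Q *m cdiag (fun k => expR (- om) * s k).
  have : U *m (hdiag U s *m V) *m U^t* = cdiag s *m Q.
    by rewrite EQ !mulmxA (unitarymxP uU) mul1mx (mulmxtVK _ uU).
  move=> <-; rewrite E -cZ -scalemxAr -scalemxAl -scalemxAr QE.
  by rewrite !mulmxA (unitarymxP uU) mul1mx (mulmxtVK _ uU).
have {}main := cdiag_intertwine (fun u => u `^ x) main.
have pE : (fun u : R => u `^ x) \o (fun k => expR (- om) * s k) =
    (fun k => expR (- (om * x)) * s k `^ x).
  apply/funext => k /=; rewrite powRM ?expR_ge0 ?(ltW (s0 k)) //; congr (_ * _).
  by rewrite /powR gt_eqF ?expR_gt0 // expRK; congr expR; ring.
rewrite pE -cZ in main.
by rewrite EQ QE -/(_ \o s) main -scalemxAr -scalemxAr -scalemxAl.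
Qed.

Lemma trmxC_comm (S V : op) (c : R) : S^t* = S ->
  S *m V = cplx c *: (V *m S) -> V^t* *m S = cplx c *: (S *m V^t*).
Proof.
move=> hS /(congr1 (fun A : op => A^t*)).
by rewrite trmxCZ conj_cplx !trmxC_mul hS.
Qed.

(** Used with [S] a power of the state: the commutator of [V] and [X] becomes a
    twisted commutator of [V] and [S X S]. *)
Lemma sandwich_commutator (S V X : op) (c : R) : c != 0 ->
  S *m V = cplx c *: (V *m S) ->
  S *m (V *m X - X *m V) *m S =
  cplx c *: (V *m (S *m X *m S)) - cplx c^-1 *: ((S *m X *m S) *m V).
Proof.
move=> c0 E; have E' : V *m S = cplx c^-1 *: (S *m V).
  by rewrite E scalerA -rmorphM mulVf // rmorph1 scale1r.
rewrite mulmxBr mulmxBl; congr (_ - _).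
  have -> : S *m (V *m X) *m S = (S *m V) *m X *m S by rewrite !mulmxA.
  by rewrite E -!scalemxAl !mulmxA.
have -> : S *m (X *m V) *m S = S *m X *m (V *m S) by rewrite !mulmxA.
by rewrite E' -scalemxAr !mulmxA.
Qed.

(** Moving [S 2^-1] past [V^t*] cancels the exponential weights of the two halves of
    the generator, which add up to [- Tr (S^(1/2) F^* S^(1/2) D)], where [F] and [D]
    are the commutators of [V] with [Z] and [X].  As [a + q a = 1/2], the powers of
    [S] can be distributed so as to conjugate [F] and [D] into twisted commutators
    of [V] with [W] and [Y], which are both diagonal in the basis [U]. *)
Lemma dirichlet_term (q a om : R) U0 s U y V X :
  U0 \is unitarymx -> (forall k, 0 < s k) -> U \is unitarymx ->
  (forall k, 0 < y k) -> a + q * a = 2^-1 ->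
  hdiag U0 s *m V *m invmx (hdiag U0 s) = cplx (expR (- om)) *: V ->
  let S x := hdiag U0 (fun k => s k `^ x) in
  S a *m X *m S a = hdiag U y ->
  let W := hdiag U (fun k => y k `^ q) in
  let Z := S (- (q * a)) *m W *m S (- (q * a)) in
  \tr (S 2^-1 *m Z^t* *m S 2^-1 *m
    (cplx (expR (- om / 2)) *: (V^t* *m (X *m V - V *m X)) +
     cplx (expR (om / 2)) *: ((V *m X - X *m V) *m V^t*))) =
  - cplx (deriv_form q (expR (- (om * a))) (expR (om * a)) U y V).
Proof.
move=> uU0 s0 uU y0 ab cV S EY W Z.
have hS x : (S x)^t* = S x by exact: trmxC_hdiag.
have SM x x' : S x *m S x' = S (x + x').
  rewrite /S (hdiagM _ _ uU0); apply: eq_hdiag => k.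
  by rewrite powRD // [s k == 0]gt_eqF ?implybT.
have S0 : S 0 = 1%:M.
  by rewrite -(hdiag1 uU0); apply: eq_hdiag => k; rewrite powRr0.
have SV x : S x *m V = cplx (expR (- (om * x))) *: (V *m S x).
  exact: hdiag_commutation.
clearbody S.
set b := q * a in Z *.
have hW : W^t* = W by exact: trmxC_hdiag.
have hZ : Z^t* = Z by rewrite /Z !trmxC_mul hS hW mulmxA.
have EZ : S b *m Z *m S b = W.
  by rewrite /Z !mulmxA SM subrr S0 mul1mx -mulmxA SM addNr S0 mulmx1.
clearbody Z.
pose D := V *m X - X *m V; pose F := V *m Z - Z *m V.
have V1 : cplx (expR (- om / 2)) *: (S 2^-1 *m V^t*) = V^t* *m S 2^-1.
  rewrite (trmxC_comm (hS _) (SV 2^-1)); congr (cplx (expR _) *: _); ring.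
have V2 : cplx (expR (om / 2)) *: (V^t* *m S 2^-1) = S 2^-1 *m V^t*.
  rewrite -V1 scalerA -rmorphM -expRD (_ : _ + _ = 0) ?expR0 ?rmorph1 ?scale1r //.
  ring.
have step1 : \tr (S 2^-1 *m Z^t* *m S 2^-1 *m
    (cplx (expR (- om / 2)) *: (V^t* *m (X *m V - V *m X)) +
     cplx (expR (om / 2)) *: ((V *m X - X *m V) *m V^t*))) =
   - \tr (S 2^-1 *m F^t* *m S 2^-1 *m D).
  rewrite hZ (mulmxDr (S 2^-1 *m Z *m S 2^-1)) mxtraceD.
  have -> : X *m V - V *m X = - D by rewrite /D opprB.
  rewrite -/D.
  have -> : S 2^-1 *m Z *m S 2^-1 *m (cplx (expR (- om / 2)) *: (V^t* *m - D)) =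
     - (S 2^-1 *m (Z *m V^t*) *m S 2^-1 *m D).
    rewrite -scalemxAr.
    have -> : S 2^-1 *m Z *m S 2^-1 *m (V^t* *m - D) =
      S 2^-1 *m Z *m (S 2^-1 *m V^t*) *m - D by rewrite !mulmxA.
    by rewrite scalemxAl scalemxAr V1 mulmxN !mulmxA.
  have -> : \tr (S 2^-1 *m Z *m S 2^-1 *m (cplx (expR (om / 2)) *: (D *m V^t*))) =
     \tr (S 2^-1 *m (V^t* *m Z) *m S 2^-1 *m D).
    have -> : S 2^-1 *m Z *m S 2^-1 *m (cplx (expR (om / 2)) *: (D *m V^t*)) =
        (S 2^-1 *m Z *m S 2^-1 *m D) *m (cplx (expR (om / 2)) *: V^t*).
      by rewrite -!scalemxAr !mulmxA.
    rewrite mxtrace_mulC.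
    have -> : cplx (expR (om / 2)) *: V^t* *m (S 2^-1 *m Z *m S 2^-1 *m D) =
        cplx (expR (om / 2)) *: (V^t* *m S 2^-1) *m (Z *m S 2^-1 *m D).
      by rewrite -!scalemxAl !mulmxA.
    by rewrite V2 !mulmxA.
  have -> : F^t* = Z *m V^t* - V^t* *m Z.
    by rewrite /F trmxCD trmxCN !trmxC_mul hZ.
  rewrite (mulmxBr (S 2^-1) (Z *m V^t*)) (mulmxBl _ _ (S 2^-1)) (mulmxBl _ _ D).
  rewrite raddfN raddfB /=; ring.
rewrite step1; congr (- _).
have EF := sandwich_commutator Z (lt0r_neq0 (expR_gt0 _)) (SV b).
have ED := sandwich_commutator X (lt0r_neq0 (expR_gt0 _)) (SV a).
rewrite EY -expRN opprK in ED; rewrite EZ -expRN opprK in EF.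
have -> : \tr (S 2^-1 *m F^t* *m S 2^-1 *m D) =
    \tr ((S b *m F *m S b)^t* *m (S a *m D *m S a)).
  rewrite !trmxC_mul hS -ab -(SM a b).
  have -> : S a *m S b *m F^t* *m (S a *m S b) *m D =
      S a *m (S b *m F^t* *m (S a *m S b) *m D) by rewrite !mulmxA.
  have SC : S a *m S b = S b *m S a by rewrite !SM addrC.
  by rewrite mxtrace_mulC SC !mulmxA.
rewrite /F /D EF ED.
set TW := (X in X^t*); set T := (X in _ *m X).
have TWe k l : (U *m TW *m U^t*) k l =
    cplx (expR (- (om * b)) * y l `^ q - expR (om * b) * y k `^ q) *
      (U *m V *m U^t*) k l.
  exact: deriv_entry.
have Te k l : (U *m T *m U^t*) k l =
    cplx (expR (- (om * a)) * y l - expR (om * a) * y k) * (U *m V *m U^t*) k l.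
  exact: deriv_entry.
have -> : \tr (TW^t* *m T) = \tr ((U *m TW *m U^t*)^t* *m (U *m T *m U^t*)).
  rewrite !trmxC_mul trmxCK [RHS]mxtrace_mulC.
  have -> : U *m T *m U^t* *m (U *m (TW^t* *m U^t*)) =
     U *m T *m (U^t* *m U) *m (TW^t* *m U^t*) by rewrite !mulmxA.
  rewrite unitarymx_mulVmx // mulmx1 [RHS]mxtrace_mulC.
  rewrite -mulmxA [U^t* *m _]mulmxA unitarymx_mulVmx // mul1mx.
  by [].
rewrite /deriv_form exchange_big /= rmorph_sum; apply: eq_bigr => l _.
rewrite mxE rmorph_sum; apply: eq_bigr => k _.
rewrite mxE mxE TWe Te !rmorphM /= conj_cplx sqnormE.
have powE (e u : R) : 0 < u -> (expR e * u) `^ q = expR (e * q) * u `^ q.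
  move=> u0; rewrite powRM ?expR_ge0 ?(ltW u0) //; congr (_ * _).
  by rewrite /powR gt_eqF ?expR_gt0 // expRK mulrC.
rewrite !powE // mulNr.
have -> : om * a * q = om * b by rewrite /b; ring.
by ring.
Qed.

(** * The two functionals of a diagonal state *)

Lemma hdiag_rank_gt0 U s k : U \is unitarymx -> nonneg_form (hdiag U s) ->
  \rank (hdiag U s) = n -> 0 < s k.
Proof.
move=> uU pS rS; have uS : hdiag U s \in unitmx by rewrite -row_full_unit /row_full rS.
pose w : 'cV[C]_n := U^t* *m delta_mx k 0.
have sk : (w^t* *m hdiag U s *m w) 0 0 = cplx (s k).
  by rewrite hdiagE /cdiag diag_mx_quad // mxE.
rewrite lt0r -cplx_ge0 -sk pS andbT; apply/eqP => sk0.
have : hdiag U s *m w = 0.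
  rewrite hdiagE /w -!mulmxA [U *m _]mulmxA (unitarymxP uU) mul1mx.
  suff -> : cdiag s *m (delta_mx k 0 : 'cV[C]_n) = 0 by rewrite mulmx0.
  apply/matrixP => i j; rewrite /cdiag mul_diag_mx !mxE.
  by have [->|_] := eqVneq i k; rewrite ?sk0 ?rmorph0 ?mul0r ?andFb ?mulr0.
move=> /(congr1 (mulmx (invmx (hdiag U s)))); rewrite mulKmx // mulmx0 => w0.
move: sk0 sk => _ _; have : U *m w = 0 by rewrite w0 mulmx0.
rewrite /w mulmxA (unitarymxP uU) mul1mx => /matrixP /(_ k 0).
by rewrite !mxE !eqxx => /eqP; rewrite oner_eq0.
Qed.

Lemma powtr1_sandwich U s X : U \is unitarymx -> (forall k, 0 < s k) -> pos_form X ->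
  powtr 1 (sandwich U 2^-1 s X) = \sum_k s k * diag_coef U X k.
Proof.
move=> uU s0 pX.
have [W uW [z z0 E]] := pos_form_spectral (pos_form_sandwich 2^-1 uU s0 pX).
rewrite E powtr_hdiag //; apply: (fmorph_inj cplx).
under eq_bigr do rewrite powRr1 ?(ltW (z0 _)) //.
rewrite -(tr_hdiag _ uW) -E.
have -> : \tr (sandwich U 2^-1 s X) = \tr (U *m sandwich U 2^-1 s X *m U^t*).
  by rewrite [RHS]mxtrace_mulC mulmxA unitarymx_mulVmx // mul1mx.
rewrite rmorph_sum /mxtrace; apply: eq_bigr => k _.
rewrite diag_coef_sandwich // (diag_coef_gt0 k uU pX).2 -rmorphM /=.
congr (cplx (_ * _)); rewrite -powRD; last by rewrite [s k == 0]gt_eqF ?implybT.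
have -> : 2^-1 + 2^-1 = 1 :> R by field.
by rewrite powRr1 // ltW.
Qed.

Lemma spectral_powR U s (e : R) : U \is unitarymx ->
  spectral_fun (fun x => x `^ e) (hdiag U s) = hdiag U (fun k => s k `^ e).
Proof. exact: spectral_fun_hdiag. Qed.

Lemma tr_dirichlet (p : R) (J : nat) U0 s U y X
    (om : 'I_J -> R) (V : 'I_J -> op) :
  1 < p -> U0 \is unitarymx -> (forall k, 0 < s k) -> U \is unitarymx ->
  (forall k, 0 < y k) -> sandwich U0 (2 * p)^-1 s X = hdiag U y ->
  (forall j, hdiag U0 s *m V j *m invmx (hdiag U0 s) =
     cplx (expR (- om j)) *: V j) ->
  let S := hdiag U0 (fun k => s k `^ 2^-1) in
  let Z := sandwich U0 (- ((p - 1) * (2 * p)^-1)) s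
             (hdiag U (fun k => y k `^ (p - 1))) in
  \tr (S *m Z^t* *m S *m
    \sum_j
      (cplx (expR (- om j / 2)) *: ((V j)^t* *m (X *m V j - V j *m X)) +
       cplx (expR (om j / 2)) *: ((V j *m X - X *m V j) *m (V j)^t*))) =
  cplx (- \sum_j deriv_form (p - 1) (expR (- (om j * (2 * p)^-1)))
             (expR (om j * (2 * p)^-1)) U y (V j)).
Proof.
move=> p1 uU0 s0 uU y0 EY cV S Z.
have ab : (2 * p)^-1 + (p - 1) * (2 * p)^-1 = 2^-1.
  by field; rewrite gt_eqF //; lra.
have D j := @dirichlet_term (p - 1) _ (om j) U0 s U y (V j) X uU0 s0 uU y0 ab (cV j) EY.
by rewrite mulmx_sumr linear_sum /= (eq_bigr _ (fun j _ => D j)) sumrN rmorphN rmorph_sum.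
Qed.

(** [deriv_form_le] with [M = (s' / s)^a], [a = 1/(2p)]: then [M^2 <= lmin^(-1/p)], and
    [exp(- a |om - nu|)] bounds both ratios of the scalars [exp(-/+ a nu)] to
    [exp(-/+ a om)].  The constant of [deriv_form_le] becomes
    [rho^(p-2) * lam^-p = exp(a |om - nu| (2 - p)) / lmin]. *)
Lemma twisted_deriv_form_le (p om nu lmin : R) U0 s s' U y U' y' V X :
  1 < p -> p <= 2 -> U0 \is unitarymx -> U \is unitarymx -> U' \is unitarymx ->
  (forall k, 0 < s k) -> (forall k, 0 < s' k) ->
  (forall k, 0 < y k) -> (forall k, 0 < y' k) ->
  sandwich U0 (2 * p)^-1 s X = hdiag U y ->
  sandwich U0 (2 * p)^-1 s' X = hdiag U' y' ->
  hdiag U0 s *m V *m invmx (hdiag U0 s) = cplx (expR (- om)) *: V ->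
  hdiag U0 s' *m V *m invmx (hdiag U0 s') = cplx (expR (- nu)) *: V ->
  0 < lmin -> (forall k, lmin * s' k <= s k) ->
  lmin * expR (- (`|om - nu| * (2 - p) / (2 * p))) *
    deriv_form (p - 1) (expR (- (nu * (2 * p)^-1))) (expR (nu * (2 * p)^-1)) U' y' V
  <= deriv_form (p - 1) (expR (- (om * (2 * p)^-1))) (expR (om * (2 * p)^-1)) U y V.
Proof.
move=> p1 p2 uU0 uU uU' s0 s'0 y0 y'0 EY EY' cV cV' l0 ls.
have p0 : 0 < p by lra.
set a := (2 * p)^-1 in EY EY' *.
have a0 : 0 < a by rewrite invr_gt0 mulr_gt0.
pose mu k := (s' k / s k) `^ a.
have m0 k : 0 < mu k by rewrite powR_gt0 // divr_gt0.
pose lam := lmin `^ p^-1; have lam0 : 0 < lam by exact: powR_gt0.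
pose rho := expR (- (a * `|om - nu|)); have rho0 : 0 < rho by exact: expR_gt0.
pose S := hdiag U0 (fun k => s k `^ a); pose S' := hdiag U0 (fun k => s' k `^ a).
pose M := hdiag U0 mu.
have mus k : mu k * s k `^ a = s' k `^ a.
  by rewrite /mu -powRM ?divfK ?gt_eqF ?divr_ge0 // ltW.
have MS : M *m S = S'.
  by rewrite /M /S (hdiagM _ _ uU0); apply: eq_hdiag => k; rewrite mus.
have SM : S *m M = S'.
  by rewrite /M /S (hdiagM _ _ uU0); apply: eq_hdiag => k; rewrite mulrC mus.
have EMY : M *m hdiag U y *m M = hdiag U' y'.
  rewrite -EY -EY' /sandwich -/S -/S' -{1}MS -SM.
  by rewrite !mulmxA.
have SV := hdiag_commutation a uU0 s0 cV; rewrite -/S in SV.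
have SV' := hdiag_commutation a uU0 s'0 cV'; rewrite -/S' in SV'.
have E1 := sandwich_commutator X (lt0r_neq0 (expR_gt0 _)) SV.
have E2 := sandwich_commutator X (lt0r_neq0 (expR_gt0 _)) SV'.
have EY1 : S *m X *m S = hdiag U y by exact: EY.
have EY2 : S' *m X *m S' = hdiag U' y' by exact: EY'.
rewrite EY1 -expRN opprK in E1; rewrite EY2 -expRN opprK in E2.
have ET : cplx (expR (- (nu * a))) *: (V *m hdiag U' y') -
      cplx (expR (nu * a)) *: (hdiag U' y' *m V) =
    M *m (cplx (expR (- (om * a))) *: (V *m hdiag U y) -
      cplx (expR (om * a)) *: (hdiag U y *m V)) *m M.
  rewrite -E1 -E2 -{1}MS -SM; set D := V *m X - X *m V; clearbody D M S.
  by rewrite !mulmxA.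
have nrm := ler_norm (om - nu); have nrm' := ler_norm (nu - om).
rewrite distrC in nrm'.
have ra : rho * expR (- (om * a)) <= expR (- (nu * a)).
  rewrite -expRD ler_expR.
  have := ler_wpM2l (ltW a0) nrm'; rewrite mulrBr; lra.
have rb : rho * expR (om * a) <= expR (nu * a).
  rewrite -expRD ler_expR.
  have := ler_wpM2l (ltW a0) nrm; rewrite mulrBr; lra.
have ml k : mu k ^+ 2 * lam <= 1.
  have -> : mu k ^+ 2 = (s' k / s k) `^ p^-1.
    rewrite -powR_mulrn ?powR_ge0 // /mu -powRrM; congr (_ `^ _).
    by rewrite /a; field; rewrite gt_eqF.
  rewrite /lam -powRM ?divr_ge0 ?(ltW l0) ?(ltW (s0 k)) ?(ltW (s'0 k)) //.
  have -> : 1 = 1 `^ p^-1 :> R by rewrite powR1.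
  have p'0 : 0 <= p^-1 by rewrite invr_ge0 ltW.
  apply: (ge0_ler_powR p'0); rewrite ?nnegrE ?ler01 //.
    by rewrite mulr_ge0 ?divr_ge0 // ltW.
  by rewrite mulrAC ler_pdivrMr // mul1r mulrC.
have q0 : 0 < p - 1 by lra.
have q1 : p - 1 <= 1 by lra.
have := deriv_form_le q0 q1 uU0 uU uU' m0 y0 y'0 EMY ET (expR_gt0 _) (expR_gt0 _)
  rho0 ra rb lam0 ml.
set D' := deriv_form _ _ _ U' _ _; set D := deriv_form _ _ _ U _ _ => H.
have cE : rho ^- 2 * (rho / lam) `^ (p - 1 + 1) =
    (lmin * expR (- (`|om - nu| * (2 - p) / (2 * p))))^-1.
  rewrite subrK powRM ?invr_ge0 ?(ltW rho0) ?(ltW lam0) //.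
  have -> : lam^-1 `^ p = lmin^-1.
    rewrite -powR_inv1 ?(ltW lam0) // -powRrM mulN1r powRN /lam -powRrM mulVf ?gt_eqF //.
    by rewrite powRr1 // ltW.
  have -> : (lmin * expR (- (`|om - nu| * (2 - p) / (2 * p))))^-1 =
      expR (`|om - nu| * (2 - p) / (2 * p)) * lmin^-1.
    by rewrite expRN invfM invrK mulrC.
  rewrite mulrA; congr (_ * _).
  rewrite /rho /powR gt_eqF ?expR_gt0 // expRK -expRM_natl -expRN -expRD.
  by congr expR; rewrite /a; field; rewrite gt_eqF.
rewrite cE in H.
have c0 : 0 < lmin * expR (- (`|om - nu| * (2 - p) / (2 * p))).
  by rewrite mulr_gt0 ?expR_gt0.
by rewrite -ler_pdivlMl.
Qed.

End Matrices.

(** * Transfer of the Beckner inequality *)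

Section ComplexOperators.
Variables (R : realType) (d : nat).
Local Notation C := R[i].
Local Notation op := 'M[C]_d.+1.

Definition toC : {rmorphism R -> C} := real_complex R.

Lemma toC_ge0 (x : R) : (0 <= toC x) = (0 <= x).
Proof. exact: ler0c. Qed.

Lemma toCK : cancel toC (@complex.Re R).
Proof. by []. Qed.

Lemma complexReK : {in Num.real, cancel (@complex.Re R) toC}.
Proof. by move=> z /RRe_real. Qed.

Local Notation hd := (@hdiag R C toC d.+1).
Local Notation sandw := (@sandwich R C toC d.+1).
Local Notation var := (@beckner_var R C toC (@complex.Re R) d.+1).
Local Notation dform := (@deriv_form R C (@complex.Re R) d.+1).

Lemma mxfunE (f : R -> R) (A : op) :
  mxfun f A = spectral_fun toC (@complex.Re R) f A.
Proof. by []. Qed.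

Lemma mxpowR_hd U s (e : R) : U \is unitarymx ->
  mxpowR (hd U s) e = hd U (fun k => s k `^ e).
Proof.
move=> uU; rewrite /mxpowR mxfunE.
exact: (spectral_powR toC_ge0 complexReK s e uU).
Qed.

Lemma Gamma_hd U s (e : R) X : U \is unitarymx ->
  Gamma (hd U s) e X = sandw U (e / 2) s X.
Proof. by move=> uU; rewrite /Gamma mxpowR_hd. Qed.

Lemma mxabs_hd W z : W \is unitarymx -> (forall k, 0 < z k) ->
  mxabs (hd W z) = hd W z.
Proof.
move=> uW z0; rewrite /mxabs.
have -> : (hd W z)^t* *m hd W z = hd W (fun k => z k * z k).
  have -> : (hd W z)^t* = hd W z by exact: (trmxC_hdiag toC_ge0).
  exact: hdiagM.
rewrite (mxpowR_hd _ _ uW); apply: (@eq_hdiag R _ toC) => k.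
by rewrite -expr2 -powR_mulrn ?(ltW (z0 k)) // -powRrM mulfV // powRr1 // ltW.
Qed.

Lemma wnorm_hd (p : R) (U : op) s X W z : U \is unitarymx -> W \is unitarymx ->
  (forall k, 0 < z k) -> sandw U (p^-1 / 2) s X = hd W z ->
  wnorm (hd U s) p X = (\sum_k z k `^ p) `^ p^-1.
Proof.
move=> uU uW z0 E; rewrite /wnorm (Gamma_hd _ _ _ uU) E (mxabs_hd uW z0).
rewrite (mxpowR_hd _ _ uW); congr (_ `^ _).
have -> : \tr (hd W (fun k => z k `^ p)) = toC (\sum_k z k `^ p).
  exact: tr_hdiag.
by [].
Qed.

Lemma dirichletE (p : R) (J : nat) (U0 : op) s U y X om V :
  1 < p -> U0 \is unitarymx -> (forall k, 0 < s k) -> U \is unitarymx ->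
  (forall k, 0 < y k) -> sandw U0 (2 * p)^-1 s X = hd U y ->
  (forall j : 'I_J, hd U0 s *m V j *m invmx (hd U0 s) = toC (expR (- om j)) *: V j) ->
  dirichlet (hd U0 s) (alicki om V) p X =
  hconj p * p / 4 *
    \sum_j dform (p - 1) (expR (- (om j * (2 * p)^-1)))
             (expR (om j * (2 * p)^-1)) U y (V j).
Proof.
move=> p1 uU0 s0 uU y0 EY cV.
have H := tr_dirichlet toC_ge0 complexReK p1 uU0 s0 uU y0 EY cV.
have eE : - (hconj p)^-1 / 2 = - ((p - 1) * (2 * p)^-1).
  by rewrite /hconj; field; rewrite !gt_eqF //; lra.
have aE : p^-1 / 2 = (2 * p)^-1 by field; rewrite gt_eqF //; lra.
rewrite /dirichlet !(Gamma_hd _ _ _ uU0) eE aE EY (mxpowR_hd _ _ uU).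
rewrite /kmsdot (mxpowR_hd _ _ uU0) /alicki /commutator.
set Z := \tr _.
have -> : Z = toC (- \sum_j dform (p - 1) (expR (- (om j * (2 * p)^-1)))
             (expR (om j * (2 * p)^-1)) U y (V j)).
  exact: H.
by rewrite toCK mulrNN.
Qed.

Lemma wnorm_var (p : R) (U : op) s X : 1 < p -> U \is unitarymx ->
  (forall k, 0 < s k) -> posdef X ->
  wnorm (hd U s) p X `^ p - wnorm (hd U s) 1 X `^ p = var p U s X.
Proof.
move=> p1 uU s0 pX; have p0 : 0 < p by lra.
have aE : p^-1 / 2 = (2 * p)^-1 by field; rewrite gt_eqF.
have oE : 1^-1 / 2 = 2^-1 :> R by rewrite invr1 mul1r.
have [W uW [z z0 E]] := pos_form_spectral toC_ge0 complexReK
  (pos_form_sandwich toC_ge0 (p^-1 / 2) uU s0 pX).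
have [W1 uW1 [z1 z10 E1]] := pos_form_spectral toC_ge0 complexReK
  (pos_form_sandwich toC_ge0 (1^-1 / 2) uU s0 pX).
rewrite (wnorm_hd uU uW z0 E) (wnorm_hd uU uW1 z10 E1).
rewrite aE in E; rewrite oE in E1.
have T1 := powtr1_sandwich toC_ge0 toCK complexReK uU s0 pX.
rewrite E1 (powtr_hdiag toC_ge0 toCK complexReK _ _ uW1) in T1.
rewrite /beckner_var E (powtr_hdiag toC_ge0 toCK complexReK _ _ uW) -T1.
rewrite invr1 [(\sum_k z1 k `^ 1) `^ 1]powRr1; last first.
  by apply: sumr_ge0 => k _; exact: powR_ge0.
rewrite -powRrM mulVf ?gt_eqF // powRr1 //.
by apply: sumr_ge0 => k _; exact: powR_ge0.
Qed.

(** At a fixed [X], passing from [s'] to [s] multiplies the left-hand functional by at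
    most [lmax] and the Dirichlet form by at least [lmin * m]. *)
Lemma beckner_transfer (p : R) (J : nat) (U0 : op) s s' (om nu : 'I_J -> R)
    (V : 'I_J -> op) (lmin lmax m a : R) :
  1 < p -> p <= 2 -> U0 \is unitarymx ->
  (forall k, 0 < s k) -> (forall k, 0 < s' k) ->
  \sum_k s k = 1 -> \sum_k s' k = 1 ->
  (forall j, hd U0 s *m V j *m invmx (hd U0 s) = toC (expR (- om j)) *: V j) ->
  (forall j, hd U0 s' *m V j *m invmx (hd U0 s') = toC (expR (- nu j)) *: V j) ->
  0 < lmin -> 0 < lmax -> 0 < m ->
  (forall k, lmin * s' k <= s k) -> (forall k, s k <= lmax * s' k) ->
  (forall j, m <= expR (- (`|om j - nu j| * (2 - p) / (2 * p)))) ->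
  beckner (hd U0 s') (alicki nu V) p a ->
  beckner (hd U0 s) (alicki om V) p (lmin / lmax * m * a).
Proof.
move=> p1 p2 uU0 s0 s'0 s1 s'1 cV cV' l0 L0 m0 ls sL mj B X pX.
have p0 : 0 < p by lra.
have q0 : 0 < p - 1 by lra.
have h0 : 0 < hconj p by rewrite divr_gt0.
have [U uU [y y0 EY]] := pos_form_spectral toC_ge0 complexReK
  (pos_form_sandwich toC_ge0 (2 * p)^-1 uU0 s0 pX).
have [U' uU' [y' y'0 EY']] := pos_form_spectral toC_ge0 complexReK
  (pos_form_sandwich toC_ge0 (2 * p)^-1 uU0 s'0 pX).
have BX := B X pX.
rewrite (wnorm_var p1 uU0 s'0 pX) (dirichletE p1 uU0 s'0 uU' y'0 EY' cV') in BX.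
rewrite (wnorm_var p1 uU0 s0 pX) (dirichletE p1 uU0 s0 uU y0 EY cV).
move: BX.
set E' := \sum_j _; set E := (X in _ -> _ <= _ * X).
have v0 := beckner_var_ge0 toC_ge0 toCK complexReK p1 uU0 pX s0 s1.
have vle := beckner_var_le toC_ge0 toCK complexReK p1 L0 uU0 pX s0 s'0 s1 s'1 sL.
set D := beckner_var _ _ _ _ s _ in v0 vle *.
set D' := beckner_var _ _ _ _ s' _ in vle *.
have E0 : 0 <= E.
  by apply: sumr_ge0 => j _; apply: (deriv_form_ge0 toC_ge0 complexReK);
    rewrite ?expR_gt0.
have EE : lmin * m * E' <= E.
  rewrite mulr_sumr; apply: ler_sum => j _.
  apply: le_trans (twisted_deriv_form_le toC_ge0 complexReK p1 p2 uU0 uU uU'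
    s0 s'0 y0 y'0 EY EY' (cV j) (cV' j) l0 ls).
  apply: ler_wpM2r; last by apply: ler_wpM2l; [exact: ltW|exact: mj].
  by apply: (deriv_form_ge0 toC_ge0 complexReK); rewrite ?expR_gt0.
have c0 : 0 < hconj p * p / 4 by apply: divr_gt0 => //; exact: mulr_gt0.
move: v0 vle E0 EE; clearbody D D' E E' => v0 vle E0 EE BX.
have [h0' c0' l0' m0'] := And4 (ltW h0) (ltW c0) (ltW l0) (ltW m0).
have lm0 : 0 <= lmin * m by rewrite mulr_ge0.
(* for [a < 0] the left-hand side is nonpositive *)
have [a0|a0] := leP 0 a; last first.
  apply: (@le_trans _ _ 0); last by rewrite mulr_ge0.
  have -> : lmin / lmax * m * a * hconj p * D = (lmin * m * hconj p * D / lmax) * a.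
    by field; rewrite gt_eqF.
  apply: mulr_ge0_le0; last exact: ltW.
  apply: mulr_ge0; last by rewrite invr_ge0 ltW.
  by apply: mulr_ge0 => //; exact: mulr_ge0.
apply: (@le_trans _ _ (lmin * m * (a * hconj p * D'))).
  have -> : lmin / lmax * m * a * hconj p * D = (lmin * m * (a * hconj p)) * (D / lmax).
    by field; rewrite gt_eqF.
  rewrite [X in _ <= X]mulrA; apply: ler_wpM2l; last by rewrite ler_pdivrMr // mulrC.
  by apply: mulr_ge0 => //; exact: mulr_ge0.
apply: (@le_trans _ _ (lmin * m * (hconj p * p / 4 * E'))).
  exact: ler_wpM2l.
have -> : lmin * m * (hconj p * p / 4 * E') = hconj p * p / 4 * (lmin * m * E').
  by ring.
exact: ler_wpM2l.
Qed.

(** Conjugated, because the eigenvectors of [hdiag U s] are the columns of [U^t*]. *)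
Definition basis_mx (v : 'I_d.+1 -> 'cV[C]_d.+1) : op := \matrix_(k, j) (v k j 0)^*.

Lemma basis_mx_unitary v : orthonormal_basis v -> basis_mx v \is unitarymx.
Proof.
move=> ov; apply/unitarymxP/matrixP => k l; rewrite mxE [RHS]mxE -ov mxE.
by apply: eq_bigr => j _; rewrite !mxE conjCK.
Qed.

Lemma sum_basis_hdiag v (s : 'I_d.+1 -> R) :
  \sum_k ((s k)%:C)%C *: (v k *m (v k)^t*) = hd (basis_mx v) s.
Proof.
apply/matrixP => i j; rewrite hdiagE -mulmxA /cdiag mul_diag_mx summxE mxE.
apply: eq_bigr => k _; rewrite !mxE big_ord1 !mxE conjCK.
by rewrite mulrCA.
Qed.

Lemma density_weights (U : op) s : U \is unitarymx -> density (hd U s) ->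
  full_rank (hd U s) -> (forall k, 0 < s k) /\ \sum_k s k = 1.
Proof.
move=> uU [pS tS] rS; split=> [k|].
  exact: (hdiag_rank_gt0 toC_ge0 k uU pS rS).
by apply: (fmorph_inj toC); rewrite -(tr_hdiag toC s uU) tS rmorph1.
Qed.

End ComplexOperators.

Theorem theorem3p27 (R : realType) (d J : nat)
  (v : 'I_d.+1 -> 'cV[R[i]]_d.+1) (s s' : 'I_d.+1 -> R)
  (sigma sigma' : 'M[R[i]]_d.+1)
  (V : 'I_J -> 'M[R[i]]_d.+1) (omega nu : 'I_J -> R)
  (P P' : R -> 'M[R[i]]_d.+1 -> 'M[R[i]]_d.+1) (p : R) :
  orthonormal_basis v ->
  sigma = \sum_k ((s k)%:C)%C *: (v k *m (v k)^t*) ->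
  sigma' = \sum_k ((s' k)%:C)%C *: (v k *m (v k)^t*) ->
  density sigma -> full_rank sigma ->
  density sigma' -> full_rank sigma' ->
  (forall j, \tr (V j) = 0) ->
  (forall i j, i != j -> hsdot (V i) (V j) = 0) ->
  (forall j, exists j', [/\ (V j)^t* = V j', omega j' = - omega j &
                            nu j' = - nu j]) ->
  (forall j, sigma *m V j *m invmx sigma
             = ((expR (- omega j))%:C)%C *: V j) ->
  (forall j, sigma' *m V j *m invmx sigma'
             = ((expR (- nu j))%:C)%C *: V j) ->
  qms P -> generator P (alicki omega V) -> primitive P ->
  gns_detailed_balance sigma (alicki omega V) ->
  qms P' -> generator P' (alicki nu V) -> primitive P' ->
  gns_detailed_balance sigma' (alicki nu V) ->
  1 < p -> p <= 2 ->
  let Lmin := \big[Num.min/s ord0 / s' ord0]_(k < d.+1) (s k / s' k) in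
  let Lmax := \big[Num.max/s ord0 / s' ord0]_(k < d.+1) (s k / s' k) in
  (* every term is at most 1, so the default value 1 only matters for J = 0 *)
  let m := \big[Num.min/1]_(j < J)
             expR (- (`|omega j - nu j| * (2 - p) / (2 * p))) in
  ((Lmin / Lmax * m)%:E * beckner_const sigma' (alicki nu V) p
     <= beckner_const sigma (alicki omega V) p)%E.
Proof.
move=> ov -> -> dS rS dS' rS' _ _ _ cV cV' _ _ _ _ _ _ _ _ p1 p2; cbv zeta.
set Lmin := \big[Num.min/s ord0 / s' ord0]_(k < d.+1) _.
set Lmax := \big[Num.max/s ord0 / s' ord0]_(k < d.+1) _.
set m := \big[Num.min/1]_(j < J) _.
have uU := basis_mx_unitary ov.
rewrite !sum_basis_hdiag in dS rS dS' rS' cV cV' *.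
have [s0 s1] := density_weights uU dS rS.
have [s'0 s'1] := density_weights uU dS' rS'.
have r0 k : 0 < s k / s' k by rewrite divr_gt0.
have l0 : 0 < Lmin by apply: lt_bigmin => [|k _]; exact: r0.
have L0 : 0 < Lmax by apply: lt_le_trans (r0 ord0) _; exact: bigmax_ge_id.
have m0 : 0 < m by apply: lt_bigmin => [|j _]; [exact: ltr01|exact: expR_gt0].
have ls k : Lmin * s' k <= s k by rewrite -ler_pdivlMr //; exact: bigmin_le.
have sL k : s k <= Lmax * s' k by rewrite -ler_pdivrMr //; exact: le_bigmax.
have mj j : m <= expR (- (`|omega j - nu j| * (2 - p) / (2 * p))).
  exact: bigmin_le.
have c0 : 0 < Lmin / Lmax * m by rewrite mulr_gt0 // divr_gt0.
rewrite muleC -lee_pdivlMr //.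
apply: ge_ereal_sup => _ [a Ba <-].
rewrite lee_pdivlMr // -EFinM mulrC.
apply: ereal_sup_ubound; exists (Lmin / Lmax * m * a); last by [].
exact: (beckner_transfer p1 p2 uU s0 s'0 s1 s'1 cV cV' l0 L0 m0 ls sL mj Ba).
Qed.
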